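(* Let $\mathbb K$ be an algebraically closed field of characteristic zero and let $u,d$ be integers with $1<u<d/2$ and $\gcd(u,d)=1$. With the notation of the context, for every integer $\ell\ge d-2$, $$\dim_{\mathbb K}\Big(\ker(\Phi_0)_{(1,\ell)}\,\big/\,\mathrm{Adj}_\ell(\mathcal C_{u,d})\cap\ker(\Phi_0)_{(1,\ell)}\Big)=\nu_{u,d},$$ where $\nu_{u,d}$ is the number of $(\alpha_0,\alpha_1,\alpha_2)\in\mathbb N^3$ with $\alpha_0+\alpha_1+\alpha_2=\ell-|\sigma_q-\tau_q|$ satisfying $$u\alpha_1+d\alpha_2<(d-1)(u-1)-d|\tau_q|\quad\text{or}\quad d\alpha_0+(d-u)\alpha_1<(d-1)(d-u-1)-(d-u)|\sigma_q-\tau_q|,$$ plus the number of $(\beta_0,\beta_1,\beta_2)\in\mathbb N^3$ with $\beta_0+\beta_1+\beta_2=\ell-|\sigma_{q+1}-\tau_{q+1}|$ satisfying $$u\beta_1+d\beta_2<(d-1)(u-1)-u|\sigma_{q+1}-\tau_{q+1}|\quad\text{or}\quad d\beta_0+(d-u)\beta_1<(d-1)(d-u-1)-d|\sigma_{q+1}|.$$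
   Context: $\mathbb N$ contains $0$. (The number $\nu_{u,d}$ does not depend on the choice of $\ell\ge d-2$, which is why $\ell$ is omitted from the notation.) $S=\mathbb K[T_0,T_1,X_0,X_1,X_2]$ is bigraded by $\mathrm{bideg}(T_i)=(1,0)$, $\mathrm{bideg}(X_j)=(0,1)$. $\Phi_0:S\to\mathbb K[T_0,T_1][Z]$ is the $\mathbb K$-algebra morphism $T_i\mapsto T_i$, $X_0\mapsto ZT_0^d$, $X_1\mapsto ZT_0^{d-u}T_1^u$, $X_2\mapsto ZT_1^d$ (its image is the Rees algebra of $\langle T_0^d,T_0^{d-u}T_1^u,T_1^d\rangle$). $\ker(\Phi_0)_{(1,\ell)}$ is the bidegree $(1,\ell)$ component of the bihomogeneous ideal $\ker(\Phi_0)$. Euclidean data: $a_0=d-u$, $a_1=u$, and for $1\le i\le p-1$, $a_{i-1}=q_ia_i+a_{i+1}$ with $0\le a_{i+1}<a_i$, where $p$ is such that $a_p=0$; $q=\sum_{i=1}^{p-1}q_i$. Put $(b_1,c_1)=(d-u,u)$, $(\sigma_1,\tau_1,\alpha_1,\beta_1)=(0,1,1,0)$ (here $\alpha_n,\beta_n$ are auxiliary integers unrelated to the exponents in the claim), and for $1\le n\le q$: if $b_n-c_n\ge c_n$, then $(b_{n+1},c_{n+1})=(b_n-c_n,c_n)$ and $(\sigma_{n+1},\tau_{n+1},\alpha_{n+1},\beta_{n+1})=(\sigma_n-\alpha_n,\tau_n-\beta_n,\alpha_n,\beta_n)$; if $b_n-c_n<c_n$, then $(b_{n+1},c_{n+1})=(c_n,b_n-c_n)$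 and $(\sigma_{n+1},\tau_{n+1},\alpha_{n+1},\beta_{n+1})=(\alpha_n,\beta_n,\sigma_n-\alpha_n,\tau_n-\beta_n)$. $\mathcal C_{u,d}\subset\mathbb P^2_{\mathbb K}$ is the image of $(t_0:t_1)\mapsto(t_0^d:t_0^{d-u}t_1^u:t_1^d)$. A plane curve $\tilde{\mathcal C}$ is adjoint to $\mathcal C$ if, for every proper or infinitely near point $p$ of $\mathcal C$, it passes through $p$ with virtual multiplicity at least $m_p(\mathcal C)-1$, i.e.: let $\pi:X\to\mathbb P^2$ be the composition of the blow-ups of all proper and infinitely near points $p$ at which (the strict transform of) $\mathcal C$ has multiplicity $m_p(\mathcal C)\ge2$, and let $E_p^*$ be the total transform in $X$ of the exceptional divisor of the blow-up of $p$; then $\pi^*\tilde{\mathcal C}-\sum_p(m_p(\mathcal C)-1)E_p^*$ is effective. $\mathrm{Adj}_\ell(\mathcal C)$ is the $\mathbb K$-vector space of pencils of adjoints of degree $\ell$: forms $T_0C^0_\ell+T_1C^1_\ell\in S$ with $C^i_\ell\in\mathbb K[X_0,X_1,X_2]$ homogeneous of degree $\ell$, each being zero or defining scheme-theoretically a curve adjoint to $\mathcal C$. *)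

(* Defs.v *)
From HB Require Import structures.
From mathcomp Require Import all_boot all_order all_algebra.
From mathcomp Require Export mpoly.

Set Implicit Arguments.
Unset Strict Implicit.
Unset Printing Implicit Defensive.

Import Order.TTheory GRing.Theory Num.Theory.
Local Open Scope ring_scope.

(* W / (V :&: W) has dimension n: some e_0, ..., e_(n-1) in W form a basis of W
   modulo V.  It is meant for linear subspaces V and W of E. *)
Definition quotient_dim (K : fieldType) (E : lmodType K) (W V : E -> Prop)
    (n : nat) : Prop :=
  exists e : 'I_n -> E,
    (forall i, W (e i)) /\
    (forall w, W w ->
       exists! c : {ffun 'I_n -> K},
         V (w - \sum_(i < n) c i *: e i) /\ W (w - \sum_(i < n) c i *: e i)).

(******************************************************************************)
(* Infinitely near points and adjoint curves                                  *)
(******************************************************************************)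

Section Adjoints.

Variable K : fieldType.

(* A point of P^2 is given by a standard chart X_i = 1 and its two affine
   coordinates c there; local_eq i c G is the equation of the curve G = 0 in the
   affine coordinates centred at that point.  A point may have several such
   descriptions. *)
Definition local_eq (i : 'I_3) (c : 'I_2 -> K) (G : {mpoly K[3]}) :
    {mpoly K[2]} :=
  G \mPo [tuple if unlift i j is Some k then 'X_k + (c k)%:MP else 1 | j < 3].

(* Multiplicity at the origin: mlast f has the least degree among the monomials
   of f, as the order on monomials is graded. *)
Definition point_mult (f : {mpoly K[2]}) : nat := mdeg (mlast f).

(* A point of the exceptional divisor of the blow-up of the origin is a tangent
   direction: Some c is the line y = c x, None the line x = 0.  The local
   coordinates (x, y) centred at it map to (x, x (y + c)), resp. (x y, y), and
   the exceptional divisor is x = 0, resp. y = 0. *)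
Definition direction : Type := option K.

Definition exc_var (t : direction) : 'I_2 := if t is Some _ then ord0 else ord_max.

Definition total_transform1 (t : direction) (f : {mpoly K[2]}) : {mpoly K[2]} :=
  f \mPo (if t is Some c then [tuple 'X_ord0; 'X_ord0 * ('X_ord_max + c%:MP)]
          else [tuple 'X_ord0 * 'X_ord_max; 'X_ord_max]).

(* The total transform divided by the (point_mult f)-th power of the equation of the
   exceptional divisor; the division is exact. *)
Definition strict_transform1 (t : direction) (f : {mpoly K[2]}) : {mpoly K[2]} :=
  \sum_(m <- msupp (total_transform1 t f))
    (total_transform1 t f)@_m *: 'X_[(m - U_(exc_var t) *+ point_mult f)%MM].

(* A point infinitely near to the origin is the sequence of the successive
   directions leading to it. *)
Fixpoint total_transform (s : seq direction) (g : {mpoly K[2]}) : {mpoly K[2]} :=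
  if s is t :: s' then total_transform s' (total_transform1 t g) else g.

(* Let X be the surface obtained by blowing up all the points, proper or
   infinitely near, at which the (strict transform of the) curve f = 0 has
   multiplicity at least 2.  The closed points of X above the origin are the
   sequences s such that all points strictly preceding s have been blown up and
   s has not. *)
Fixpoint on_resolution (f : {mpoly K[2]}) (s : seq direction) : Prop :=
  match s with
  | [::] => (point_mult f < 2)%N
  | t :: s' => (2 <= point_mult f)%N /\ on_resolution (strict_transform1 t f) s'
  end.

(* Equation, at the point s of X, of the divisor \sum_p (m_p - 1) E_p^*; only
   the points p below s contribute. *)
Fixpoint virtual_eq (f : {mpoly K[2]}) (s : seq direction) : {mpoly K[2]} :=
  match s with
  | [::] => 1
  | t :: s' => total_transform s' ('X_(exc_var t) ^+ (point_mult f).-1)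
               * virtual_eq (strict_transform1 t f) s'
  end.

(* Divisibility in the local ring of the plane at the origin. *)
Definition loc_dvd (h g : {mpoly K[2]}) : Prop :=
  exists s r : {mpoly K[2]}, s.@[fun=> 0] != 0 /\ s * g = r * h.

(* C is a plane curve, given by the set of its homogeneous coordinate vectors;
   F is an equation of C, i.e. a generator of its ideal. *)
Definition curve_equation (C : ('I_3 -> K) -> Prop) (F : {mpoly K[3]}) : Prop :=
  forall G : {mpoly K[3]},
    (exists H, G = H * F) <-> (forall x, C x -> G.@[x] = 0).

(* A divisor on X is effective iff its local equation at each closed point is
   regular there; for \pi^* G - \sum_p (m_p - 1) E_p^* this is a divisibility. *)
Definition adjoint (C : ('I_3 -> K) -> Prop) (G : {mpoly K[3]}) : Prop :=
  exists2 F : {mpoly K[3]}, curve_equation C F &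
    forall (i : 'I_3) (c : 'I_2 -> K) (s : seq direction),
      on_resolution (local_eq i c F) s ->
      loc_dvd (virtual_eq (local_eq i c F) s) (total_transform s (local_eq i c G)).

End Adjoints.

(******************************************************************************)
(* The curve C_{u,d} and the pencils in ker Phi_0                             *)
(******************************************************************************)

Section Rees.

Variables (K : fieldType) (u d : nat).

Definition param (j : 'I_3) : {mpoly K[2]} :=
  tnth [tuple 'X_ord0 ^+ d; 'X_ord0 ^+ (d - u) * 'X_ord_max ^+ u; 'X_ord_max ^+ d] j.

Definition curve (x : 'I_3 -> K) : Prop :=
  exists (t : 'I_2 -> K) (c : K),
    (exists i, t i != 0) /\ c != 0 /\ forall j, x j = c * (param j).@[t].

(* S = K[T_0, T_1, X_0, X_1, X_2]: the first two variables are the T_i. *)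
Definition T_ (i : 'I_2) : {mpoly K[2 + 3]} := 'X_(lshift 3 i).
Definition X_ (j : 'I_3) : {mpoly K[2 + 3]} := 'X_(rshift 2 j).

Definition bihomog (a b : nat) (f : {mpoly K[2 + 3]}) : Prop :=
  forall m, m \in msupp f ->
    (\sum_(i < 2) m (lshift 3 i))%N = a /\ (\sum_(j < 3) m (rshift 2 j))%N = b.

(* Phi_0 : S -> K[T_0, T_1][Z]; the variable Z is 'X. *)
Definition Phi0 (f : {mpoly K[2 + 3]}) : {poly {mpoly K[2]}} :=
  mmap (fun c : K => (c%:MP)%:P)
       (fun k => match split k with
                 | inl i => ('X_i)%:P
                 | inr j => 'X * (param j)%:P
                 end) f.

Definition kerPhi0 (a b : nat) (f : {mpoly K[2 + 3]}) : Prop :=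
  bihomog a b f /\ Phi0 f = 0.

Definition Adj (l : nat) (f : {mpoly K[2 + 3]}) : Prop :=
  exists C : 'I_2 -> {mpoly K[3]},
    (forall i, C i \is l.-homog /\ (C i = 0 \/ adjoint curve (C i))) /\
    f = \sum_(i < 2) T_ i * (C i \mPo [tuple X_ j | j < 3]).

End Rees.

(******************************************************************************)
(* The number nu_{u,d}                                                        *)
(******************************************************************************)

Definition euclid_data (u d p : nat) (a qs : nat -> nat) : Prop :=
  [/\ a 0%N = (d - u)%N, a 1%N = u, a p = 0%N &
      forall i, (1 <= i <= p - 1)%N ->
        a i.-1 = (qs i * a i + a i.+1)%N /\ (a i.+1 < a i)%N].

Definition euclid_sum (p : nat) (qs : nat -> nat) : nat :=
  (\sum_(1 <= i < p) qs i)%N.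

Record state := State {
  st_b : int; st_c : int;
  st_sigma : int; st_tau : int; st_alpha : int; st_beta : int }.

Definition next_state (s : state) : state :=
  let: State b c sg ta al be := s in
  if c <= b - c then State (b - c) c (sg - al) (ta - be) al be
  else State c (b - c) al be (sg - al) (ta - be).

(* Indexed from 1. *)
Definition state_at (u d n : nat) : state :=
  iter n.-1 next_state (State (d%:Z - u%:Z) u%:Z 0 1 1 0).

Definition sigma (u d n : nat) : int := st_sigma (state_at u d n).
Definition tau (u d n : nat) : int := st_tau (state_at u d n).

(* Number of (x_0, x_1, x_2) in N^3 with x_0 + x_1 + x_2 = l - e and
   (u x_1 + d x_2 < A or d x_0 + (d - u) x_1 < B).  For e >= 0 such x_i are at
   most l. *)
Definition triple_count (u d l : nat) (e A B : int) : nat :=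
  #|[set x : 'I_l.+1 * 'I_l.+1 * 'I_l.+1 |
      let x0 := (x.1.1 : nat)%:Z in
      let x1 := (x.1.2 : nat)%:Z in
      let x2 := (x.2 : nat)%:Z in
      (x0 + x1 + x2 == l%:Z - e) &&
      ((u%:Z * x1 + d%:Z * x2 < A) || (d%:Z * x0 + (d%:Z - u%:Z) * x1 < B))]|.

Definition nu (u d q l : nat) : nat :=
  let D := d%:Z in
  let U := u%:Z in
  let A := (D - 1) * (U - 1) in
  let B := (D - 1) * (D - U - 1) in
  let e := `|sigma u d q - tau u d q| in
  let e' := `|sigma u d q.+1 - tau u d q.+1| in
  (triple_count u d l e (A - D * `|tau u d q|) (B - (D - U) * e)
   + triple_count u d l e' (A - U * e') (B - D * `|sigma u d q.+1|))%N.

(* Main.v *)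
(** G is adjoint to C_{u,d} iff its restriction t |-> G(1, t^u, t^d) involves
    only exponents j with (d-1)(u-1) <= j and (d-1)(d-u-1) <= d l - j: the only
    singular points of the curve are the cusps (t^u, t^d) and (t^(d-u), t^d), and
    blowing up the points of multiplicity m_p of a cusp (t^b, t^a) removes
    sum_p m_p (m_p - 1) = (a-1)(b-1) from the order along the branch.  Below these
    conductors a monomial of degree l is determined by its exponent on the curve.
    A pencil T_0 A + T_1 B in ker Phi_0 has A(1, t^u, t^d) = t h and
    B(1, t^u, t^d) = - h, and lies in Adj iff the coefficients of h at the
    positions j < (d-1)(u-1) or d l - 1 - j < (d-1)(d-u-1) vanish.  Such a
    position carries a nonzero coefficient for some pencil iff j and j + 1 are
    both exponents of monomials of degree l, and then it is the position of
    exactly one multiple by a monomial of one of the binomial pencils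
      T_0 X_1^e - T_1 X_0^(e-t) X_2^t          (u e = d t + 1),
      T_0 X_0^(e'-t') X_2^t' - T_1 X_1^e'      (d t' = u e' + 1),
    where e + e' = d.  The last two states of Euclid's algorithm give (e, t) and
    (e', t') in an order that depends on a parity; for the wrong order the bounds
    in nu are off by one, which is harmless since (d-1)(u-1) - 1 is not in the
    semigroup generated by u and d. *)
Require Import Defs.
From mathcomp Require Import all_boot all_order all_algebra.
From mathcomp Require Import zify ring.
From HB Require Import structures.
Import GRing.Theory Num.Theory.
Local Open Scope ring_scope.

Set Implicit Arguments.
Unset Strict Implicit.
Unset Printing Implicit Defensive.

Lemma mpoly_rmorph_ext (K : comNzRingType) (n : nat) (S : nzRingType)
    (f g : {rmorphism {mpoly K[n]} -> S}) :
  (forall c, f c%:MP = g c%:MP) -> (forall i, f 'X_i = g 'X_i) -> f =1 g.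
Proof.
move=> eqC eqX G; rewrite (mpolyE G) !rmorph_sum /=; apply: eq_bigr => m _.
rewrite -mul_mpolyC !rmorphM /= eqC mpolyXE_id !rmorph_prod /=; congr (_ * _).
by apply: eq_bigr => i _; rewrite !rmorphXn /= eqX.
Qed.

Lemma ord2E (i : 'I_2) : i = ord0 \/ i = ord_max.
Proof. by case: i => [[|[|i]] Hi]; [left; apply: val_inj|right; apply: val_inj|]. Qed.

(** * Restriction of polynomials to monomial curves *)

Section MonomialEvaluation.

Variables (K : fieldType) (n : nat).
Implicit Types (w : 'I_n -> nat) (m : 'X_{1..n}) (G : {mpoly K[n]}).

Definition wdeg w m : nat := (\sum_i w i * m i)%N.

(** Pullback of G along the arc s |-> (s^(w i))_i, from which the order of vanishing along a branch
    is read off. *)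
Definition evw w G : {poly K} := mmap polyC (fun i => 'X^(w i)) G.

HB.instance Definition _ w :=
  GRing.RMorphism.copy (evw w) (mmap polyC (fun i => 'X^(w i))).

Lemma wdeg0 w : wdeg w 0 = 0%N.
Proof. by rewrite /wdeg big1 // => i _; rewrite mnm0E muln0. Qed.

Lemma evwC w c : evw w c%:MP = c%:P.
Proof. exact: mmapC. Qed.

Lemma evwXU w i : evw w 'X_i = 'X^(w i).
Proof. by rewrite /evw mmapX mmap1U. Qed.

Lemma evwX w m : evw w 'X_[m] = 'X^(wdeg w m).
Proof.
rewrite /evw mmapX /mmap1 /wdeg -prodrXr.
by apply: eq_bigr => i _; rewrite exprM.
Qed.

Lemma evwZ w c G : evw w (c *: G) = c *: evw w G.
Proof. by rewrite -mul_mpolyC rmorphM /= evwC mul_polyC. Qed.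

Lemma coef_evw w G k :
  (evw w G)`_k = \sum_(m <- msupp G | wdeg w m == k) G@_m.
Proof.
rewrite {1}(mpolyE G) rmorph_sum /= coef_sum [RHS]big_mkcond /=.
apply: eq_bigr => m _; rewrite evwZ evwX coefZ coefXn eq_sym.
by case: eqP => _; rewrite ?mulr1 ?mulr0.
Qed.

(** A weight carried by a single monomial of the support leaves no room for cancellation; [m0]
    itself may lie outside the support, and then both sides vanish. *)
Lemma coef_evw_uniq w G m0 :
  (forall m, m \in msupp G -> wdeg w m = wdeg w m0 -> m = m0) ->
  (evw w G)`_(wdeg w m0) = G@_m0.
Proof.
move=> uniq_m0; rewrite coef_evw.
have [m0G|m0G] := boolP (m0 \in msupp G).
  rewrite big_mkcond (bigD1_seq m0) ?msupp_uniq //= eqxx big_seq_cond big1.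
    by rewrite addr0.
  move=> m /andP[mG m_neq]; case: eqP => // /(uniq_m0 _ mG) mE.
  by rewrite mE eqxx in m_neq.
rewrite memN_msupp_eq0 // big_seq_cond big1 // => m /andP[mG /eqP].
by move=> /(uniq_m0 _ mG) mE; rewrite mE (negPf m0G) in mG.
Qed.

Lemma coef_evw_neq0 w G k : (evw w G)`_k != 0 ->
  exists2 m, m \in msupp G & wdeg w m = k.
Proof.
rewrite coef_evw; have [/hasP[m mG /eqP <-] _|] :=
  boolP (has (fun m => wdeg w m == k) (msupp G)); first by exists m.
by move=> nh; rewrite big_hasC // eqxx.
Qed.

End MonomialEvaluation.

(** * Adjoints of a plane cusp *)

Section LocalTheory.

Variable K : fieldType.
Implicit Types (f g h : {mpoly K[2]}) (s : seq (direction K)) (t : direction K).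

Local Notation x := ('X_(ord0 : 'I_2) : {mpoly K[2]}).
Local Notation y := ('X_(ord_max : 'I_2) : {mpoly K[2]}).
Local Notation at0 f := (f.@[fun=> 0]).

Lemma meval0_mcoeff0 (n : nat) (f : {mpoly K[n]}) : f.@[fun=> 0] = f@_0%MM.
Proof.
apply: (mpoly_rmorph_ext (f := meval _) (g := mcoeff 0%MM)) => [c|i] /=.
  by rewrite mevalC mcoeffC eqxx mulr1.
by rewrite mevalXU mcoeffX mnm1_eq0.
Qed.

Lemma point_mult_le (f : {mpoly K[2]}) m : m \in msupp f -> (point_mult f <= mdeg m)%N.
Proof. by move=> mf; apply: lemc_mdeg; apply: mlast_lemc. Qed.

Lemma point_mult_unit f : at0 f != 0 -> point_mult f = 0%N.
Proof.
rewrite meval0_mcoeff0 -mcoeff_msupp => /point_mult_le.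
by rewrite mdeg0 leqn0 => /eqP.
Qed.

Lemma on_resolution_smooth f s :
  (point_mult f < 2)%N -> on_resolution f s -> s = [::].
Proof. by case: s => [//|t s] lt2 /= [ge2 _]; rewrite leqNgt lt2 in ge2. Qed.

Definition blowup_map t : 2.-tuple {mpoly K[2]} :=
  if t is Some c then [tuple x; x * (y + c%:MP)] else [tuple x * y; y].

HB.instance Definition _ t :=
  GRing.RMorphism.copy (total_transform1 t) (comp_mpoly (blowup_map t)).

Lemma total_transformE s : exists T : {rmorphism {mpoly K[2]} -> {mpoly K[2]}},
  total_transform s =1 T.
Proof.
elim: s => [|t s [T sT]]; first by exists idfun.
by exists (T \o total_transform1 t) => f /=; rewrite sT.
Qed.

Lemma total_transformM s : {morph total_transform s : f g / f * g}.
Proof. by move=> f g; have [T sT] := total_transformE s; rewrite !sT rmorphM. Qed.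

Lemma total_transform1C t c : total_transform1 t c%:MP = c%:MP.
Proof. exact: comp_mpolyC. Qed.

Lemma total_transform1_Some_x c : total_transform1 (Some c) x = x.
Proof. exact: comp_mpolyXU. Qed.

Lemma total_transform1_Some_y c : total_transform1 (Some c) y = x * (y + c%:MP).
Proof. exact: comp_mpolyXU. Qed.

Lemma total_transform1_None_x : total_transform1 None x = x * y.
Proof. exact: comp_mpolyXU. Qed.

Lemma total_transform1_None_y : total_transform1 None y = y.
Proof. exact: comp_mpolyXU. Qed.

Definition total_transform1XE := (total_transform1_Some_x, total_transform1_Some_y,
  total_transform1_None_x, total_transform1_None_y).

(** Multiplying by a power of the exceptional variable only shifts exponents, so once the total
    transform is visibly such a multiple, the truncated subtraction of exponents is an exact
    division. *)
Lemma strict_transform1_eq t f g :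
  total_transform1 t f = 'X_(exc_var t) ^+ point_mult f * g ->
  strict_transform1 t f = g.
Proof.
rewrite /strict_transform1 mulrC mpolyXn => ->.
rewrite (perm_big _ (msuppMX _ _)) big_map [RHS]mpolyE.
by apply: eq_bigr => m _; rewrite mcoeffMX addmC addmK.
Qed.

Lemma loc_dvd_unit f : loc_dvd 1 f.
Proof. by exists 1, f; rewrite meval1 oner_neq0 mul1r mulr1. Qed.

Lemma loc_dvd_mul2l f g h : loc_dvd g h -> loc_dvd (f * g) (f * h).
Proof.
by move=> [s [r [s0 sh]]]; exists s, r; split=> //; rewrite mulrCA sh mulrCA.
Qed.

Lemma loc_dvdD f g h : loc_dvd f g -> loc_dvd f h -> loc_dvd f (g + h).
Proof.
move=> [s [r [s0 sg]]] [s' [r' [s0' sh]]].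
exists (s * s'), (s' * r + s * r'); rewrite mevalM mulf_neq0 //; split=> //.
by rewrite mulrDr mulrDl -!mulrA -sh -sg; ring.
Qed.

Lemma loc_dvdZ f g c : loc_dvd f g -> loc_dvd f (c *: g).
Proof.
by move=> [s [r [s0 sg]]]; exists s, (c *: r); rewrite -scalerAr sg scalerAl.
Qed.

Lemma loc_dvd0 f : loc_dvd f 0.
Proof. by exists 1, 0; rewrite meval1 oner_neq0 mul0r mulr0. Qed.

(** The branch is s |-> (s^b, s^a). The scalar k is kept because an equation of the curve is fixed
    only up to a constant, and because the second cusp appears with the opposite sign. *)
Definition cusp (k : K) (a b : nat) : {mpoly K[2]} := k *: (x ^+ a - y ^+ b).

Lemma point_mult_cusp k a b : k != 0 -> (0 < a)%N -> (0 < b)%N ->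
  point_mult (cusp k a b) = minn a b.
Proof.
move=> k0 a0 b0.
have neq_ab : (U_(ord0 : 'I_2) *+ a == U_(ord_max : 'I_2) *+ b)%MM = false.
  apply/eqP => /mnmP/(_ ord0); rewrite !mulmnE !mnm1E /=; lia.
have coefE m : (cusp k a b)@_m =
    k * (((U_(ord0) *+ a)%MM == m)%:R - ((U_(ord_max) *+ b)%MM == m)%:R).
  by rewrite /cusp mcoeffZ mcoeffB !mcoeffXn.
have xS : (U_(ord0) *+ a)%MM \in msupp (cusp k a b).
  by rewrite mcoeff_msupp coefE eqxx (eq_sym (U_(_) *+ b)%MM) neq_ab subr0 mulr1.
have yS : (U_(ord_max) *+ b)%MM \in msupp (cusp k a b).
  by rewrite mcoeff_msupp coefE eqxx neq_ab sub0r mulrN1 oppr_eq0.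
have := point_mult_le xS; have := point_mult_le yS.
rewrite !mdegMn !mdeg1 !mul1n => le_b le_a; apply/eqP.
rewrite eqn_leq leq_min le_a le_b /=.
have /mlast_supp : cusp k a b != 0.
  by apply: contraTneq xS => ->; rewrite msupp0.
rewrite mcoeff_msupp coefE /point_mult; move: (mlast _) => m.
have [<- _|_] := eqVneq (U_(ord0) *+ a)%MM m.
  by rewrite mdegMn mdeg1 mul1n geq_minl.
have [<- _|_] := eqVneq (U_(ord_max) *+ b)%MM m.
  by rewrite mdegMn mdeg1 mul1n geq_minr.
by rewrite subrr mulr0 eqxx.
Qed.

End LocalTheory.

(** Along the branch (s^b, s^a) the monomial x^i y^j has order b i + a j, to be compared with the
    conductor (a-1)(b-1). Blowing up the point of multiplicity a and dividing by the power a-1 of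
    the exceptional equation lowers both by a (a-1), leaving the same condition for the cusp with
    exponents a and b-a. *)
Lemma conductor_step a b i j : (0 < a < b)%N -> (a.-1 * b.-1 <= b * i + a * j)%N ->
  (a.-1 <= i + j)%N /\
  (a.-1 * (b - a).-1 <= (b - a) * i + a * (i + j - a.-1))%N.
Proof.
case: a => // a /andP[_ /subnKC <-] /=; set c := (b - a.+2)%N.
rewrite (_ : (a.+2 + c - a.+1 = c.+1)%N); last by lia.
rewrite /= => le_ij; have le_a : (a <= i + j)%N.
  rewrite leqNgt; apply/negP => lt_a.
  have : (a.+1 * (i + j).+1 <= a.+1 * a)%N by rewrite leq_mul2l lt_a orbT.
  have : (c.+1 * i <= c.+1 * a)%N by rewrite leq_mul2l; lia.
  nia.
split=> //; rewrite -(leq_add2l (a.+1 * a)).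
rewrite (_ : (a.+1 * a + (c.+1 * i + a.+1 * (i + j - a)) = c.+1 * i + a.+1 * (i + j))%N).
  by nia.
by rewrite addnCA -mulnDr subnKC.
Qed.

Lemma coprime_subr a b : (a <= b)%N -> coprime a b -> coprime a (b - a).
Proof. by move=> le_ab; rewrite -{1}(subnKC le_ab) /coprime gcdnDl. Qed.

Section CuspResolution.

Variables (K : fieldType) (k : K).
Hypothesis k_neq0 : k != 0.
Implicit Types (f g h : {mpoly K[2]}) (s : seq (direction K)) (t : direction K).

Local Notation x := ('X_(ord0 : 'I_2) : {mpoly K[2]}).
Local Notation y := ('X_(ord_max : 'I_2) : {mpoly K[2]}).
Local Notation at0 f := (f.@[fun=> 0]).

Lemma total_transform1_cusp t a b :
  total_transform1 t (cusp k a b) =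
  k *: (total_transform1 t x ^+ a - total_transform1 t y ^+ b).
Proof. by rewrite /cusp [LHS]comp_mpolyZ -/(total_transform1 _ _) rmorphB !rmorphXn. Qed.

Lemma strict_cusp_gt a b : (0 < b < a)%N ->
  strict_transform1 (Some 0) (cusp k a b) = cusp k (a - b) b.
Proof.
move=> /andP[b0 ltba]; apply: strict_transform1_eq.
rewrite total_transform1_cusp !total_transform1XE point_mult_cusp //; last lia.
rewrite (minn_idPr (ltnW ltba)) /= addr0 exprMn /cusp -scalerAr mulrBr -exprD.
by rewrite subnKC // ltnW.
Qed.

(** The tangent cone is a power of y, so the branch meets the exceptional divisor in the direction
    [Some 0] only; elsewhere the strict transform is a unit and the resolution stops. *)
Lemma strict_cusp_gt_smooth a b t : (0 < b < a)%N -> t != Some 0 ->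
  at0 (strict_transform1 t (cusp k a b)) != 0.
Proof.
move=> /andP[b0 ltba] t_neq.
have a0 : (0 < a)%N by lia.
pose g := k *: (if t is Some c then x ^+ (a - b) - (y + c%:MP) ^+ b
                else x ^+ a * y ^+ (a - b) - 1).
rewrite (strict_transform1_eq (g := g)); last first.
  rewrite point_mult_cusp // (minn_idPr (ltnW ltba)) total_transform1_cusp /g.
  case: (t) => [c|] /=; rewrite !total_transform1XE.
    by rewrite -scalerAr mulrBr -exprD subnKC ?exprMn // ltnW.
  by rewrite -scalerAr mulrBr mulr1 mulrCA -exprD subnKC ?exprMn // ltnW.
rewrite mevalZ mulf_neq0 //; case: t t_neq {g} => [c|_].
  rewrite (inj_eq (@Some_inj _)) => c0.
  rewrite mevalB !rmorphXn /= mevalD mevalC !mevalXU expr0n subn_eq0 leqNgt ltba.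
  by rewrite !add0r oppr_eq0 expf_neq0.
rewrite mevalB mevalM !rmorphXn /= !mevalXU meval1 expr0n eqn0Ngt a0 mul0r add0r.
by rewrite oppr_eq0 oner_neq0.
Qed.

Lemma strict_cusp_lt a b : (0 < a < b)%N ->
  strict_transform1 None (cusp k a b) = cusp k a (b - a).
Proof.
move=> /andP[a0 ltab]; apply: strict_transform1_eq.
rewrite total_transform1_cusp !total_transform1XE point_mult_cusp //; last lia.
rewrite (minn_idPl (ltnW ltab)) /= exprMn /cusp -scalerAr mulrBr -exprD.
by rewrite subnKC 1?mulrC // ltnW.
Qed.

Lemma strict_cusp_lt_smooth a b t : (0 < a < b)%N -> t != None ->
  at0 (strict_transform1 t (cusp k a b)) != 0.
Proof.
move=> /andP[a0 ltab]; case: t => // c _.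
have b0 : (0 < b)%N by lia.
rewrite (strict_transform1_eq (g := k *: (1 - x ^+ (b - a) * (y + c%:MP) ^+ b))).
  rewrite mevalZ mulf_neq0 // mevalB mevalM !rmorphXn /= !mevalXU meval1 expr0n.
  by rewrite subn_eq0 leqNgt ltab mul0r subr0 oner_neq0.
rewrite point_mult_cusp // (minn_idPl (ltnW ltab)) total_transform1_cusp.
rewrite !total_transform1XE -scalerAr mulrBr mulr1 mulrA -exprD subnKC ?exprMn //.
exact: ltnW.
Qed.

Lemma total_transform1_monomial t i j n : (n <= i + j)%N ->
  total_transform1 t (x ^+ i * y ^+ j) = 'X_(exc_var t) ^+ n *
    (if t is Some c then x ^+ (i + j - n) * (y + c%:MP) ^+ j
     else x ^+ i * y ^+ (i + j - n)).
Proof.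
move=> le_n; rewrite rmorphM !rmorphXn /=.
case: t => [c|]; rewrite !total_transform1XE exprMn.
  by rewrite /= [RHS]mulrA -exprD subnKC // exprD !mulrA.
by rewrite /= [RHS]mulrCA -exprD subnKC // exprD !mulrA.
Qed.

(** Induction along s. Each blow-up takes out of the monomial exactly the factor that it contributes
    to [virtual_eq]; on the branch [conductor_step] hands the order condition on to the next cusp,
    and off the branch nothing more has to be divided. *)
Lemma adjoint_monomial s a b i j : coprime a b -> (0 < a)%N -> (0 < b)%N ->
  (a.-1 * b.-1 <= b * i + a * j)%N -> on_resolution (cusp k a b) s ->
  loc_dvd (virtual_eq (cusp k a b) s) (total_transform s (x ^+ i * y ^+ j)).
Proof.
elim: s a b i j => [|t s IHs] a b i j cop_ab a0 b0 le_ij /=.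
  by move=> _; apply: loc_dvd_unit.
rewrite point_mult_cusp // => -[mult_ge2 res_s].
have [ltba|ltab|eq_ab] := ltngtP b a; last first.
- by move: cop_ab mult_ge2; rewrite eq_ab /coprime gcdnn minnn => /eqP ->.
- have [|le_m le_ij'] := conductor_step _ le_ij; first by rewrite a0.
  have cop_ab' := coprime_subr (ltnW ltab) cop_ab.
  rewrite (total_transform1_monomial t le_m).
  rewrite total_transformM; apply: loc_dvd_mul2l.
  have [t_eq|t_neq] := eqVneq t None.
    subst t; rewrite strict_cusp_lt ?a0 // in res_s *.
    by apply: (IHs _ _ _ _ cop_ab' _ _ _ res_s) => //; rewrite subn_gt0.
  have /point_mult_unit mult0 : at0 (strict_transform1 t (cusp k a b)) != 0.
    by apply: strict_cusp_lt_smooth => //; rewrite a0.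
  by rewrite (on_resolution_smooth _ res_s) ?mult0 //=; apply: loc_dvd_unit.
(* The same step with the roles of x and y exchanged. *)
- rewrite mulnC (addnC (b * i)%N) in le_ij; rewrite coprime_sym in cop_ab.
  have [|le_m le_ij'] := conductor_step _ le_ij; first by rewrite b0.
  have := coprime_subr (ltnW ltba) cop_ab; rewrite coprime_sym => cop_ab'.
  rewrite (addnC j) in le_m le_ij'.
  rewrite (total_transform1_monomial t le_m).
  rewrite total_transformM; apply: loc_dvd_mul2l.
  have [t_eq|t_neq] := eqVneq t (Some 0).
    subst t; rewrite strict_cusp_gt ?b0 // in res_s *.
    rewrite addr0; apply: (IHs _ _ _ _ cop_ab' _ _ _ res_s) => //.
      by rewrite subn_gt0.
    by rewrite mulnC addnC.
  have /point_mult_unit mult0 : at0 (strict_transform1 t (cusp k a b)) != 0.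
    by apply: strict_cusp_gt_smooth => //; rewrite b0.
  by rewrite (on_resolution_smooth _ res_s) ?mult0 //=; apply: loc_dvd_unit.
Qed.

Definition weight2 (p q : nat) (i : 'I_2) : nat := if i == ord0 then p else q.

(** The blow-up maps the arc (s^p, s^q) upstairs to (s^p, s^(p+q)); in this way orders along the
    branch are carried through the resolution. *)
Lemma evw_total_transform1_Some0 p q f :
  evw (weight2 p q) (total_transform1 (Some 0) f) = evw (weight2 p (p + q)) f.
Proof.
pose T : {rmorphism {mpoly K[2]} -> {mpoly K[2]}} := total_transform1 (Some 0).
apply: (mpoly_rmorph_ext (f := evw (weight2 p q) \o T)) => [c|i] /=.
  by rewrite total_transform1C !evwC.
have [->|->] := ord2E i.
  by rewrite total_transform1XE !evwXU.
by rewrite total_transform1XE addr0 rmorphM /= !evwXU exprD.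
Qed.

Lemma evw_total_transform1_None p q f :
  evw (weight2 p q) (total_transform1 None f) = evw (weight2 (p + q) q) f.
Proof.
pose T : {rmorphism {mpoly K[2]} -> {mpoly K[2]}} := total_transform1 None.
apply: (mpoly_rmorph_ext (f := evw (weight2 p q) \o T)) => [c|i] /=.
  by rewrite total_transform1C !evwC.
have [->|->] := ord2E i.
  by rewrite total_transform1XE rmorphM /= !evwXU exprD.
by rewrite total_transform1XE !evwXU.
Qed.

(* The points of the branch are followed by Euclid's subtractive algorithm; the
   conductor drops from (a-1)(b-1) to (a-b-1)(b-1) when a point of multiplicity b
   is blown up. *)
Lemma cusp_branch n a b : (a + b <= n)%N -> coprime a b -> (0 < a)%N -> (0 < b)%N ->
  exists s p q, [/\ on_resolution (cusp k a b) s, (0 < p)%N, (0 < q)%N,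
    evw (weight2 p q) (virtual_eq (cusp k a b) s) = 'X^(a.-1 * b.-1) &
    forall g, evw (weight2 p q) (total_transform s g) = evw (weight2 b a) g].
Proof.
elim: n a b => [|n IHn] a b le_n cop_ab a0 b0; first by lia.
have [mult1|mult2] := ltnP (minn a b) 2.
  exists [::], b, a; split=> //=; first by rewrite point_mult_cusp.
  by rewrite rmorph1 (_ : (a.-1 * b.-1)%N = 0%N) //; nia.
have [ltba|ltab|eq_ab] := ltngtP b a; last first.
- by move: cop_ab mult2; rewrite eq_ab /coprime gcdnn minnn => /eqP ->.
- have min_a := minn_idPl (ltnW ltab).
  have [|||s [p [q [res p0 q0 virt tot]]]] :=
    IHn a (b - a)%N _ (coprime_subr (ltnW ltab) cop_ab); rewrite ?subn_gt0 //.
    by rewrite subnKC ?(ltnW ltab) //; lia.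
  exists (None :: s), p, q; split=> //=.
  + by rewrite point_mult_cusp // strict_cusp_lt ?a0.
  + rewrite rmorphM /= point_mult_cusp // min_a strict_cusp_lt ?a0 // virt tot.
    rewrite rmorphXn /= evwXU -exprM -exprD; congr ('X^_); rewrite /weight2 /=.
    by rewrite (mulnC a) -mulnDr; congr (_ * _)%N; lia.
  + by move=> g; rewrite tot evw_total_transform1_None subnK // ltnW.
- have min_b := minn_idPr (ltnW ltba).
  rewrite coprime_sym in cop_ab.
  have := coprime_subr (ltnW ltba) cop_ab; rewrite coprime_sym => cop_ab'.
  have [|||s [p [q [res p0 q0 virt tot]]]] :=
    IHn (a - b)%N b _ cop_ab'; rewrite ?subn_gt0 //.
    by rewrite subnK ?(ltnW ltba) //; lia.
  exists (Some 0 :: s), p, q; split=> //=.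
  + by rewrite point_mult_cusp // strict_cusp_gt ?b0.
  + rewrite rmorphM /= point_mult_cusp // min_b strict_cusp_gt ?b0 // virt tot.
    rewrite rmorphXn /= evwXU -exprM -exprD; congr ('X^_); rewrite /weight2 /=.
    by rewrite -mulnDl; congr (_ * _)%N; lia.
  + by move=> g; rewrite tot evw_total_transform1_Some0 subnKC // ltnW.
Qed.

(** The divisibility is restricted to the branch at the point where the resolved branch passes:
    [virtual_eq] has order exactly (a-1)(b-1) there, and the denominator h has a nonzero constant
    term, so it is prime to ['X] and can be cancelled. *)
Lemma adjoint_order a b g : coprime a b -> (0 < a)%N -> (0 < b)%N ->
  (forall s, on_resolution (cusp k a b) s ->
     loc_dvd (virtual_eq (cusp k a b) s) (total_transform s g)) ->
  forall j, (j < a.-1 * b.-1)%N -> (evw (weight2 b a) g)`_j = 0.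
Proof.
move=> cop_ab a0 b0 adj_g j lt_j.
have [s [p [q [res p0 q0 virt tot]]]] := cusp_branch (leqnn _) cop_ab a0 b0.
have [h [r [h0 /(congr1 (evw (weight2 p q)))]]] := adj_g s res.
rewrite !rmorphM /= virt tot => dvd_g.
have /dvdpP[P ->] : ('X^(a.-1 * b.-1) %| evw (weight2 b a) g)%R.
  rewrite -(@Gauss_dvdpr _ _ (evw (weight2 p q) h)); first by rewrite dvd_g dvdp_mull.
  rewrite coprimep_expl // coprimep_sym coprimepX /root horner_coef0.
  have := @coef_evw_uniq _ _ (weight2 p q) h 0%MM; rewrite wdeg0 => ->.
    by rewrite -meval0_mcoeff0.
  move=> m _ /eqP; rewrite sum_nat_eq0 => /forallP m0.
  apply/mnmP => i; rewrite mnm0E; apply/eqP.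
  by move: (m0 i); rewrite /= muln_eq0 /weight2; case: ifP => _; lia.
by rewrite coefMXn lt_j.
Qed.

End CuspResolution.

(** * The curve and its adjoints *)

(** Modulo d the factor u is invertible, so [a1] and [b1] are congruent, and both are reduced. *)
Lemma weight_inj u d a1 a2 b1 b2 : (0 < d)%N -> coprime u d ->
  (a1 < d)%N -> (b1 < d)%N ->
  (u * a1 + d * a2 = u * b1 + d * b2)%N -> a1 = b1 /\ a2 = b2.
Proof.
move=> d0 cop_ud lta ltb eq_ab.
have /eqP : (u * a1 = u * b1 %[mod d])%N.
  by rewrite -(modnMDl a2) -(modnMDl b2 (u * b1)) mulnC addnC eq_ab addnC mulnC.
wlog le_ba : a1 b1 a2 b2 lta ltb eq_ab / (b1 <= a1)%N => [IH|].
  have [|lt] := leqP b1 a1; first by apply: IH.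
  by rewrite eq_sym => h; have [] := IH _ _ _ _ ltb lta (esym eq_ab) (ltnW lt) h.
rewrite eqn_mod_dvd ?leq_mul2l ?le_ba ?orbT // -mulnBr.
rewrite Gauss_dvdr; last by rewrite coprime_sym.
move=> /dvdn_leq le_d; have eq1 : a1 = b1 by lia.
by split=> //; move: eq_ab; rewrite eq1 => /addnI /eqP; rewrite eqn_mul2l; lia.
Qed.

Section PlaneCurve.

Variable K : fieldType.
Hypothesis closedK : forall P : {poly K}, size P != 1%N -> exists s, root P s.

(** A nonzero P would make ['X * P + 1] nonconstant; its root is nonzero and P does not vanish
    there. *)
Lemma closed_poly_eq0 (P : {poly K}) : (forall s, s != 0 -> P.[s] = 0) -> P = 0.
Proof.
move=> P0; apply/eqP; apply: contraT => nzP.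
have [|s /rootP] := closedK (P := 'X * P + 1).
  rewrite size_polyDl mulrC size_mulX // ?size_poly1 //.
    by rewrite eqSS size_poly_eq0.
  by rewrite ltnS size_poly_gt0.
rewrite hornerD hornerM hornerX hornerC.
have [->|s0] := eqVneq s 0; first by rewrite mul0r add0r => /eqP; rewrite oner_eq0.
by rewrite P0 // mulr0 add0r => /eqP; rewrite oner_eq0.
Qed.

Lemma horner_evw n (w : 'I_n -> nat) (G : {mpoly K[n]}) s :
  (evw w G).[s] = G.@[fun i => s ^+ w i].
Proof.
apply: (mpoly_rmorph_ext (f := horner_eval s \o evw w) (g := meval _)) => [c|i] /=.
  by rewrite evwC mevalC /horner_eval hornerC.
by rewrite evwXU mevalXU /horner_eval hornerXn.
Qed.

Definition o1 : 'I_3 := lift ord0 ord0.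

Lemma ord3E (i : 'I_3) : [\/ i = ord0, i = o1 | i = ord_max].
Proof.
case: i => [[|[|[|i]]] Hi]; [apply: Or31|apply: Or32|apply: Or33|by []];
  exact: val_inj.
Qed.

Definition weight3 (p q r : nat) (i : 'I_3) : nat := nth 0%N [:: p; q; r] i.

Lemma wdeg3 p q r m :
  wdeg (weight3 p q r) m = (p * m ord0 + q * m o1 + r * m ord_max)%N.
Proof.
rewrite /wdeg !big_ord_recl big_ord0 addn0 addnA.
by rewrite (_ : lift ord0 (lift ord0 ord0) = ord_max) //; apply: val_inj.
Qed.

Lemma mdeg3 (m : 'X_{1..3}) : mdeg m = (m ord0 + m o1 + m ord_max)%N.
Proof.
rewrite mdegE !big_ord_recl big_ord0 addn0 addnA.
by rewrite (_ : lift ord0 (lift ord0 ord0) = ord_max) //; apply: val_inj.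
Qed.

Variables u d : nat.
Hypotheses (u_gt1 : (1 < u)%N) (u_lt : (2 * u < d)%N) (cop_ud : coprime u d).

Definition form : {mpoly K[3]} :=
  'X_o1 ^+ d - 'X_ord0 ^+ (d - u) * 'X_ord_max ^+ u.

(** Division by [form], which is monic in X_1: X_1^d is traded for X_0^(d-u) X_2^u until the
    exponent of X_1 drops below d. Among such remainders, degree and weight determine a monomial. *)
Lemma form_division (G : {mpoly K[3]}) : exists H R : {mpoly K[3]},
  G = H * form + R /\ forall m : 'X_{1..3}, (d <= m o1)%N -> R@_m = 0.
Proof.
rewrite (mpolyE G); elim/big_rec: _ => [|m G' _ [H [R [-> R0]]]].
  by exists 0, 0; rewrite mul0r addr0; split=> // m _; rewrite mcoeff0.
suff [H' [R' [-> R'0]]] : exists H' R' : {mpoly K[3]},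
    'X_[m] = H' * form + R' /\ forall m : 'X_{1..3}, (d <= m o1)%N -> R'@_m = 0.
  exists (G@_m *: H' + H), (G@_m *: R' + R); split; last first.
    by move=> m' lem'; rewrite mcoeffD mcoeffZ R0 ?R'0 // mulr0 addr0.
  by rewrite scalerDr mulrDl -scalerAl addrACA.
have [n] := ubnP (m o1); elim: n m => // n IHn m lt_n.
have [lt_d|le_d] := ltnP (m o1) d.
  exists 0, 'X_[m]; rewrite mul0r add0r; split=> // m' le_m'.
  by rewrite mcoeffX; case: eqP => // mm'; move: lt_d; rewrite mm' ltnNge le_m'.
have le_m : (U_(o1) *+ d <= m)%MM.
  apply/mnm_lepP => i; rewrite mulmnE mnm1E; case: eqP => [<-|_].
    by rewrite mul1n.
  by rewrite mul0n.
pose m' := (m - U_(o1) *+ d)%MM.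
have [|H1 [R1 [mE R1_0]]] := IHn (m' + U_(ord0) *+ (d - u) + U_(ord_max) *+ u)%MM.
  rewrite !mnmDE mnmBE !mulmnE !mnm1E /= !mul0n mul1n; lia.
exists ('X_[m'] + H1), R1; split=> //.
rewrite mulrDl -addrA -mE !mpolyXD -!mpolyXn /form -{1}(submK le_m) -/m'.
rewrite mpolyXD -mpolyXn; ring.
Qed.

Lemma curve_parametrized (s : K) c : c != 0 ->
  curve u d (fun i => c * s ^+ weight3 0 u d i).
Proof.
move=> c0; exists (fun i : 'I_2 => if i == ord0 then 1 else s), c.
split; first by exists ord0; rewrite oner_neq0.
split=> // j; congr (_ * _); have [->|->|->] := ord3E j; rewrite /param /tnth /=.
- by rewrite rmorphXn /= mevalXU expr1n.
- by rewrite rmorphM !rmorphXn /= !mevalXU expr1n mul1r.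
- by rewrite rmorphXn /= mevalXU.
Qed.

Lemma form_curve x : curve u d x -> form.@[x] = 0.
Proof.
move=> [t [c [_ [_ xE]]]].
rewrite /form rmorphB rmorphM !rmorphXn /= !mevalXU !xE /param /tnth /=.
rewrite !(rmorphM, rmorphXn) /= !mevalXU.
have le_ud : (u <= d)%N by lia.
rewrite !exprMn -!exprM (mulnC (d - u)%N d) (mulnC u d) -{1}(subnK le_ud) exprD; ring.
Qed.

(** The remainder of G modulo [form] vanishes on the cone over the curve, where its monomials
    restrict to distinct powers of the parameter, so it is zero. *)
Lemma curve_equation_form : curve_equation (curve u d) form.
Proof.
move=> G; split=> [[H ->] x /form_curve Fx|G0]; first by rewrite mevalM Fx mulr0.
have [H [R [GE R0]]] := form_division G; exists H.
suff R_eq0 : R = 0 by rewrite GE R_eq0 addr0.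
(* Scaling the point of parameter s by s^N gives a monomial the exponent N times its degree plus its
   weight. As N exceeds all weights in R, both can be recovered; G need not be homogeneous. *)
pose N := (d * msize R).+1; have d_gt0 : (0 < d)%N by lia.
have evw0 : evw (weight3 N (N + u) (N + d)) R = 0.
  apply: closed_poly_eq0 => s s0; rewrite horner_evw.
  have := curve_parametrized s (expf_neq0 N s0) => /[dup] /form_curve Fs.
  move=> /G0; rewrite GE mevalD mevalM.
  set v := (fun i => _) in Fs *; rewrite Fs mulr0 add0r => <-.
  apply: meval_eq => i; rewrite /v -exprD.
  by have [->|->|->] := ord3E i; rewrite /weight3 /= ?addn0.
apply/eqP; rewrite -msupp_eq0; case msE : (msupp R) => [//|m0 ms].
have m0R : m0 \in msupp R by rewrite msE mem_head.
have := congr1 (fun P : {poly K} => P`_(wdeg (weight3 N (N + u) (N + d)) m0)) evw0.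
rewrite /= coef0 coef_evw_uniq => [/eqP|m mR].
  by rewrite mcoeff_eq0 m0R.
have ltd m' : m' \in msupp R -> (m' o1 < d)%N.
  by rewrite mcoeff_msupp ltnNge; apply: contra => /R0 ->.
have ltN m' : m' \in msupp R -> (u * m' o1 + d * m' ord_max < N)%N.
  move=> /msize_mdeg_lt; rewrite mdeg3 /N ltnS => lt_m.
  apply: leq_trans (_ : (d * (m' o1 + m' ord_max) <= _)%N).
    by rewrite mulnDr leq_add2r leq_mul2r; lia.
  by rewrite leq_mul2l; lia.
have wdegE m' : wdeg (weight3 N (N + u) (N + d)) m' =
    (mdeg m' * N + (u * m' o1 + d * m' ord_max))%N.
  by rewrite wdeg3 mdeg3; lia.
rewrite !wdegE => eq_w.
have eq_deg : mdeg m = mdeg m0.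
  have := congr1 (divn^~ N) eq_w.
  by rewrite !divnMDl // !divn_small ?ltN // !addn0.
move: eq_w; rewrite eq_deg => /addnI.
move=> /(weight_inj d_gt0 cop_ud (ltd _ mR) (ltd _ m0R))[eq1 eq2].
apply/mnmP => i; move: eq_deg; rewrite !mdeg3 eq1 eq2 => eq0.
by have [->|->|->] := ord3E i => //; lia.
Qed.

(** Two generators of the same ideal divide each other, and invertible polynomials are constants. *)
Lemma curve_equation_unique (F : {mpoly K[3]}) : curve_equation (curve u d) F ->
  exists2 k, k != 0 & F = k *: form.
Proof.
move=> eqF.
have [|A FE] := proj2 (eqF form); first exact: form_curve.
have [|B formE] := proj2 (curve_equation_form F).
  by apply/(proj1 (eqF F)); exists 1; rewrite mul1r.
have nz : form != 0.
  apply/eqP => /(congr1 (mcoeff (U_(o1) *+ d)%MM)) /eqP.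
  rewrite mcoeffB !mpolyXn -mpolyXD !mcoeffX eqxx mcoeff0.
  have -> : (U_(ord0) *+ (d - u) + U_(ord_max) *+ u == U_(o1) *+ d)%MM = false.
    by apply/eqP => /mnmP/(_ ord0); rewrite mnmDE !mulmnE !mnm1E /=; lia.
  by rewrite subr0 oner_eq0.
have /mpoly_intro_unit/andP[/eqP BE unitB] : A * B = 1.
  by apply: (mulIf nz); rewrite mul1r -mulrA -formE -FE.
exists B@_0; first by rewrite unitfE in unitB.
by rewrite formE {1}BE mul_mpolyC.
Qed.

End PlaneCurve.

(** * Adjunction as a condition on the orders at the two cusps *)

Section AdjointOrder.

Variable K : fieldType.
Hypothesis closedK : forall P : {poly K}, size P != 1%N -> exists s, root P s.
Hypothesis charK : [pchar K] =i pred0.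
Implicit Types (G : {mpoly K[3]}) (i : 'I_3) (c : 'I_2 -> K).

Local Notation x := ('X_(ord0 : 'I_2) : {mpoly K[2]}).
Local Notation y := ('X_(ord_max : 'I_2) : {mpoly K[2]}).

Definition chart_map i c : 3.-tuple {mpoly K[2]} :=
  [tuple if unlift i j is Some k then 'X_k + (c k)%:MP else 1 | j < 3].

HB.instance Definition _ i c :=
  GRing.RMorphism.copy (local_eq i c) (comp_mpoly (chart_map i c)).

Lemma local_eqC i c k : local_eq i c k%:MP = k%:MP.
Proof. exact: comp_mpolyC. Qed.

Lemma local_eqZ i c k G : local_eq i c (k *: G) = k *: local_eq i c G.
Proof. exact: comp_mpolyZ. Qed.

Lemma local_eq_lift i c k : local_eq i c 'X_(lift i k) = 'X_k + (c k)%:MP.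
Proof. by rewrite /local_eq /comp_mpoly mmapX mmap1U tnth_mktuple liftK. Qed.

Lemma local_eq_self i c : local_eq i c 'X_i = 1.
Proof. by rewrite /local_eq /comp_mpoly mmapX mmap1U tnth_mktuple unlift_none. Qed.

Lemma lift0_max : lift (ord0 : 'I_3) (ord_max : 'I_2) = ord_max.
Proof. exact: val_inj. Qed.

Lemma lift1_0 : lift o1 (ord0 : 'I_2) = ord0.
Proof. exact: val_inj. Qed.

Lemma lift1_max : lift o1 (ord_max : 'I_2) = ord_max.
Proof. exact: val_inj. Qed.

Lemma lift_max_0 : lift (ord_max : 'I_3) (ord0 : 'I_2) = ord0.
Proof. exact: val_inj. Qed.

Lemma lift_max_max : lift (ord_max : 'I_3) (ord_max : 'I_2) = o1.
Proof. exact: val_inj. Qed.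

Lemma local_eq0 c :
  [/\ local_eq ord0 c 'X_ord0 = 1, local_eq ord0 c 'X_o1 = x + (c ord0)%:MP &
      local_eq ord0 c 'X_ord_max = y + (c ord_max)%:MP].
Proof.
split; [exact: local_eq_self|exact: local_eq_lift|].
by rewrite -{1}lift0_max local_eq_lift.
Qed.

Lemma local_eq1 c :
  [/\ local_eq o1 c 'X_ord0 = x + (c ord0)%:MP, local_eq o1 c 'X_o1 = 1 &
      local_eq o1 c 'X_ord_max = y + (c ord_max)%:MP].
Proof.
split; [|exact: local_eq_self|].
  by rewrite -{1}lift1_0 local_eq_lift.
by rewrite -{1}lift1_max local_eq_lift.
Qed.

Lemma local_eq2 c :
  [/\ local_eq ord_max c 'X_ord0 = x + (c ord0)%:MP,
      local_eq ord_max c 'X_o1 = y + (c ord_max)%:MP &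
      local_eq ord_max c 'X_ord_max = 1].
Proof.
split; [| |exact: local_eq_self].
  by rewrite -{1}lift_max_0 local_eq_lift.
by rewrite -{1}lift_max_max local_eq_lift.
Qed.

(** With positive weights, the weight of a monomial is at least its degree. *)
Lemma point_mult_coef (f : {mpoly K[2]}) p q j : (0 < p)%N -> (0 < q)%N ->
  (j < point_mult f)%N -> (evw (weight2 p q) f)`_j = 0.
Proof.
move=> p0 q0 lt_j; apply/eqP; apply: contraT => /coef_evw_neq0[m mf wm].
have := leq_trans lt_j (point_mult_le mf); rewrite ltnNge -wm /wdeg mdegE => /negP[].
by apply: leq_sum => i _; rewrite leq_pmull // /weight2; case: ifP.
Qed.

Lemma coef1_horner (P : {poly K}) : P`_1 = P^`().[0].
Proof. by rewrite horner_coef0 coef_deriv mulr1n. Qed.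

Lemma natr_neq0 n : (0 < n)%N -> n%:R != 0 :> K.
Proof. by move=> n0; have /pcharf0P -> := charK; rewrite -lt0n. Qed.

(** P is the equation of the curve along an arc (a + s, b + s^2). The second coordinate has no
    linear term, so the linear coefficient is m a^(m-1); in characteristic zero this forces a = 0,
    and then the constant term forces b = 0. *)
Lemma binomial_order_ge2 a b m n : (1 < m)%N -> (0 < n)%N ->
  let P := ('X + a%:P) ^+ m - ('X^2 + b%:P) ^+ n : {poly K} in
  P`_0 = 0 -> P`_1 = 0 -> a = 0 /\ b = 0.
Proof.
move=> m1 n0 /=; rewrite coef1_horner -horner_coef0 /=.
rewrite derivB !deriv_exp !derivD !derivC derivX derivXn /= !addr0.
rewrite !(hornerMn, hornerE) /= expr0n /= add0r mul0rn mul0r mul0rn subr0.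
move=> eq_ab /eqP; rewrite -mulr_natr mulf_eq0 expf_eq0 (negPf (natr_neq0 _)) ?(ltnW m1) //.
rewrite orbF => /andP[_ /eqP a0]; split=> //; move: eq_ab.
rewrite a0 expr0n gtn_eqF ?(ltnW m1) // sub0r => /eqP.
by rewrite oppr_eq0 expf_eq0 => /andP[_ /eqP].
Qed.

(** The same arc in the chart X_1 = 1: the constant term makes a and b nonzero, and then the linear
    coefficient - m a^(m-1) b^n cannot vanish. *)
Lemma binomial_order_ge2_unit a b m n : (0 < m)%N -> (0 < n)%N ->
  let P := 1 - ('X + a%:P) ^+ m * ('X^2 + b%:P) ^+ n : {poly K} in
  P`_0 = 0 -> P`_1 = 0 -> False.
Proof.
move=> m0 n0 /=; rewrite coef1_horner -horner_coef0 /=.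
rewrite derivB -(polyC1 K) derivM !deriv_exp !derivD !derivC derivX derivXn /= !addr0.
rewrite !(hornerMn, hornerE) /= expr0n /= add0r mul0rn mul0r mul0rn mulr0 addr0.
move=> /eqP; rewrite subr_eq0 => /eqP eq1 /eqP; rewrite oppr_eq0.
have : a ^+ m * b ^+ n != 0 by rewrite -eq1 oner_neq0.
rewrite mulf_eq0 !expf_eq0 m0 n0 /= negb_or => /andP[a0 b0].
rewrite -mulr_natr !mulf_eq0 !expf_eq0 (negPf a0) (negPf b0) !andbF !orbF /=.
by rewrite (negPf (natr_neq0 _)).
Qed.

Variables u d l : nat.
Hypotheses (u_gt1 : (1 < u)%N) (u_lt : (2 * u < d)%N) (cop_ud : coprime u d).

Local Notation form := (form K u d).

Lemma evw_shift (p q : nat) a (i : 'I_2) :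
  evw (weight2 p q) ('X_i + a%:MP) = 'X^(weight2 p q i) + a%:P :> {poly K}.
Proof. by rewrite rmorphD /= evwXU evwC. Qed.

(** A curve of multiplicity at least 2 has order at least 2 along every arc through the point. One
    arc per chart, with weights 1 and 2 on the coordinates, leaves only (1:0:0) and (0:0:1). *)
Lemma form_singular i c : (2 <= point_mult (local_eq i c form))%N ->
  (i = ord0 \/ i = ord_max) /\ c =1 fun=> 0.
Proof.
move=> ge2; pose P p q := evw (weight2 p q) (local_eq i c form).
have P0 p q : (0 < p)%N -> (0 < q)%N -> (P p q)`_0 = 0.
  by move=> p0 q0; apply: point_mult_coef; rewrite ?(ltnW ge2).
have P1 p q : (0 < p)%N -> (0 < q)%N -> (P p q)`_1 = 0.
  by move=> p0 q0; apply: point_mult_coef.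
have PE p q : P p q =
    evw (weight2 p q) (local_eq i c 'X_o1) ^+ d -
    evw (weight2 p q) (local_eq i c 'X_ord0) ^+ (d - u) *
    evw (weight2 p q) (local_eq i c 'X_ord_max) ^+ u.
  by rewrite /P /form !(rmorphB, rmorphM, rmorphXn).
have c0E : c ord0 = 0 /\ c ord_max = 0 -> c =1 fun=> 0.
  move=> [c0 c1] j; case: j => [[|[|j]] Hj] //.
    by rewrite -c0; congr c; apply: val_inj.
  by rewrite -c1; congr c; apply: val_inj.
have [iE|iE|iE] := ord3E i; subst i.
- split; first by left.
  have [X0 X1 X2] := local_eq0 c.
  move: (P0 1 2)%N (P1 1 2)%N; rewrite PE X0 X1 X2 !evw_shift rmorph1 expr1n mul1r.
  rewrite /weight2 /= expr1 => P0' P1'; apply: c0E.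
  by apply: binomial_order_ge2 (P0' _ _) (P1' _ _) => //; lia.
- have [X0 X1 X2] := local_eq1 c.
  move: (P0 1 2)%N (P1 1 2)%N; rewrite PE X0 X1 X2 !evw_shift rmorph1 expr1n.
  rewrite /weight2 /= expr1 => P0' P1'; exfalso.
  by apply: binomial_order_ge2_unit (P0' _ _) (P1' _ _) => //; lia.
- split; first by right.
  have [X0 X1 X2] := local_eq2 c.
  move: (P0 2 1)%N (P1 2 1)%N; rewrite PE X0 X1 X2 !evw_shift rmorph1 expr1n mulr1.
  rewrite /weight2 /= expr1 => P0' P1'; apply: c0E.
  have [] // := binomial_order_ge2 _ _ (P0' _ _) (P1' _ _); lia.
Qed.

Lemma local_form_first k : local_eq ord0 (fun=> 0) (k *: form) = cusp k d u.
Proof.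
have [X0 X1 X2] := local_eq0 (fun=> 0 : K).
rewrite local_eqZ /form !(rmorphB, rmorphM, rmorphXn) /= X0 X1 X2.
by rewrite expr1n mul1r mpolyC0 !addr0.
Qed.

Lemma local_form_last k : local_eq ord_max (fun=> 0) (k *: form) = cusp (- k) (d - u) d.
Proof.
have [X0 X1 X2] := local_eq2 (fun=> 0 : K).
rewrite local_eqZ /form !(rmorphB, rmorphM, rmorphXn) /= X0 X1 X2.
by rewrite expr1n mulr1 mpolyC0 !addr0 /cusp scaleNr -scalerN opprB.
Qed.

Lemma evw_local_first p q G :
  evw (weight2 p q) (local_eq ord0 (fun=> 0) G) = evw (weight3 0 p q) G.
Proof.
have [X0 X1 X2] := local_eq0 (fun=> 0 : K).
pose T : {rmorphism {mpoly K[3]} -> {mpoly K[2]}} := local_eq ord0 (fun=> 0 : K).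
apply: (mpoly_rmorph_ext (f := evw (weight2 p q) \o T)) => [c|i] /=.
  by rewrite local_eqC !evwC.
by have [->|->|->] := ord3E i;
  rewrite ?X0 ?X1 ?X2 ?evw_shift ?rmorph1 evwXU /weight2 /weight3 /= ?addr0.
Qed.

Lemma evw_local_last p q G :
  evw (weight2 p q) (local_eq ord_max (fun=> 0) G) = evw (weight3 p q 0) G.
Proof.
have [X0 X1 X2] := local_eq2 (fun=> 0 : K).
pose T : {rmorphism {mpoly K[3]} -> {mpoly K[2]}} := local_eq ord_max (fun=> 0 : K).
apply: (mpoly_rmorph_ext (f := evw (weight2 p q) \o T)) => [c|i] /=.
  by rewrite local_eqC !evwC.
by have [->|->|->] := ord3E i;
  rewrite ?X0 ?X1 ?X2 ?evw_shift ?rmorph1 evwXU /weight2 /weight3 /= ?addr0.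
Qed.

Lemma coprime_du : coprime (d - u) d.
Proof.
have le_ud : (u <= d)%N by lia.
have := coprime_subr le_ud cop_ud.
by rewrite coprime_sym => /eqP cop; rewrite /coprime -{2}(subnK le_ud) gcdnDl cop.
Qed.

Lemma adjoint_coef G : adjoint (curve u d) G ->
  (forall j, (j < d.-1 * u.-1)%N -> (evw (weight3 0 u d) G)`_j = 0) /\
  (forall j, (j < (d - u).-1 * d.-1)%N -> (evw (weight3 d (d - u) 0) G)`_j = 0).
Proof.
move=> [F /curve_equation_unique[] // k k0 -> adj_G].
split=> j lt_j.
  rewrite -evw_local_first; apply: (adjoint_order k0) lt_j; try lia.
    by rewrite coprime_sym.
  by move=> s; rewrite -local_form_first; apply: adj_G.
have nk0 : - k != 0 by rewrite oppr_eq0.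
rewrite -evw_local_last; apply: (adjoint_order nk0) lt_j; try lia.
  exact: coprime_du.
by move=> s; rewrite -local_form_last; apply: adj_G.
Qed.

Lemma loc_dvd_sum (h : {mpoly K[2]}) (T : {rmorphism {mpoly K[3]} -> {mpoly K[2]}}) G :
  (forall k : K, T k%:MP = k%:MP) ->
  (forall m, m \in msupp G -> loc_dvd h (T 'X_[m])) -> loc_dvd h (T G).
Proof.
move=> TC dvd_h; rewrite (mpolyE G) rmorph_sum big_seq /=.
elim/big_rec: _ => [|m g mG dvd_g]; first exact: loc_dvd0.
by apply: loc_dvdD => //; rewrite -mul_mpolyC rmorphM TC mul_mpolyC; apply/loc_dvdZ/dvd_h.
Qed.

(** Local divisibility may be checked monomial by monomial. Where the curve is smooth [virtual_eq]
    is 1, so only the two cusps remain, and there [adjoint_monomial] applies. *)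
Lemma monomials_adjoint G :
  (forall m, m \in msupp G -> (d.-1 * u.-1 <= u * m o1 + d * m ord_max)%N /\
     ((d - u).-1 * d.-1 <= d * m ord0 + (d - u) * m o1)%N) ->
  adjoint (curve u d) G.
Proof.
move=> mG; exists form; first exact: curve_equation_form.
move=> i c s res_s.
have [lt2|ge2] := ltnP (point_mult (local_eq i c form)) 2.
  by rewrite (on_resolution_smooth lt2 res_s); apply: loc_dvd_unit.
have [iE c0] := form_singular ge2.
have [S SE] := total_transformE s.
have tt_C (k : K) : total_transform s k%:MP = k%:MP.
  by elim: (s) => //= t s' IH; rewrite total_transform1C.
have cE (H : {mpoly K[3]}) : local_eq i c H = local_eq i (fun=> 0) H.
  rewrite /local_eq; congr (_ \mPo _); apply: eq_from_tnth => j.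
  by rewrite !tnth_mktuple; case: unlift => // k; rewrite c0.
rewrite !cE SE in res_s *.
pose T : {rmorphism {mpoly K[3]} -> {mpoly K[2]}} := local_eq i (fun=> 0 : K).
apply: (loc_dvd_sum (T := S \o T)) => [k|m /mG[ge1 ge2']] /=.
  by rewrite local_eqC -SE tt_C.
rewrite -SE /T mpolyXE_id !big_ord_recl big_ord0 mulr1 !rmorphM !rmorphXn /=.
rewrite -[lift ord0 ord0]/o1 (_ : lift ord0 (lift ord0 ord0) = ord_max); last first.
  exact: val_inj.
rewrite -[form]scale1r in res_s *.
case: iE => iE; subst i.
  have [-> -> ->] := local_eq0 (fun=> 0 : K).
  rewrite expr1n mul1r mpolyC0 !addr0; rewrite local_form_first in res_s *.
  apply: adjoint_monomial => //; rewrite ?oner_neq0 //; try lia.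
  by rewrite coprime_sym.
have [-> -> ->] := local_eq2 (fun=> 0 : K).
rewrite expr1n mulr1 mpolyC0 !addr0; rewrite local_form_last in res_s *.
apply: adjoint_monomial => //; rewrite ?oppr_eq0 ?oner_neq0 //; try lia.
exact: coprime_du.
Qed.

(** Exchanging the two cusps replaces the parameter t by 1/t, hence the exponent j by d l - j in
    degree l. *)
Lemma coef_evw_reverse G j : G \is l.-homog -> (j <= d * l)%N ->
  (evw (weight3 d (d - u) 0) G)`_(d * l - j) = (evw (weight3 0 u d) G)`_j.
Proof.
move=> /dhomogP homG le_j; rewrite !coef_evw.
rewrite big_seq_cond [RHS]big_seq_cond; apply: eq_bigl => m.
have [mG|//] := boolP (m \in msupp G).
have lE := homG _ mG; rewrite /= mdeg3 in lE; rewrite -lE in le_j *.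
rewrite !wdeg3 /= -[in RHS](eqn_add2r (d * m ord0 + (d - u) * m o1)).
have : (d * m o1 = u * m o1 + (d - u) * m o1)%N by rewrite -mulnDl subnKC //; lia.
lia.
Qed.

(** The first alternative concerns the cusp at t = 0, the second the cusp at t = infinity, where t^j
    has order d l - j. *)
Definition below_conductor (j : nat) : bool :=
  (j < d.-1 * u.-1)%N || (d * l - j < (d - u).-1 * d.-1)%N.

(* Below the conductors a monomial of degree l is determined by its weight, so
   the vanishing of a coefficient on the curve is that of a coefficient of G. *)
Lemma adjointP G : G \is l.-homog ->
  adjoint (curve u d) G <->
  forall j, (j <= d * l)%N -> below_conductor j -> (evw (weight3 0 u d) G)`_j = 0.
Proof.
move=> homG; split=> [/adjoint_coef[ord1 ord2] j le_j /orP[/ord1 //|lt_j]|G0].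
  by rewrite -coef_evw_reverse // ord2.
apply: monomials_adjoint => m mG.
have d0 : (0 < d)%N by lia.
have degE m' : m' \in msupp G -> (m' ord0 + m' o1 + m' ord_max = l)%N.
  by move=> /(dhomog_mf homG) /=; rewrite mdeg3.
have wt m' : m' \in msupp G ->
    (u * m' o1 + d * m' ord_max + (d * m' ord0 + (d - u) * m' o1) = d * l)%N.
  move=> /degE <-; have -> : (d * (m' ord0 + m' o1 + m' ord_max) =
    d * m' ord0 + (u + (d - u)) * m' o1 + d * m' ord_max)%N.
    by rewrite subnKC; lia.
  lia.
have uniqE m' : m' \in msupp G -> m' o1 = m o1 ->
    m' ord0 = m ord0 \/ m' ord_max = m ord_max -> m' = m.
  move=> m'G eq1 eq02; apply/mnmP => i.
  have := degE m' m'G; have := degE m mG.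
  by have [->|->|->] := ord3E i; lia.
pose j := (u * m o1 + d * m ord_max)%N.
have wtm := wt m mG.
(* A weight below the conductor has no room for an exponent of X_1 at least d, as [weight_inj]
   requires. *)
have lt_d a b v : (v * a + d * b < v.-1 * d.-1 -> a < d)%N.
  move=> lt_ab; rewrite ltnNge; apply/negP => le_da.
  by have : (v * d <= v * a)%N; [rewrite leq_mul2l le_da orbT|nia].
suff nj : ~~ below_conductor j.
  by split; rewrite leqNgt; apply: contra nj => lt_m; apply/orP; lia.
apply: contraL mG => bad_j; rewrite mcoeff_msupp negbK; apply/eqP.
rewrite -(G0 j) //; last by rewrite /j; lia.
have jE : wdeg (weight3 0 u d) m = j by rewrite wdeg3.
rewrite -jE coef_evw_uniq // => m' m'G; rewrite !wdeg3 !mul0n !add0n => eq_w.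
have wtm' := wt m' m'G.
case/orP: bad_j => lt_m.
  have [eq1 eq2] : m' o1 = m o1 /\ m' ord_max = m ord_max.
    apply: (weight_inj d0 cop_ud _ _ eq_w).
      by apply: (lt_d _ (m' ord_max) u); lia.
    by apply: (lt_d _ (m ord_max) u); lia.
  by apply: uniqE => //; right.
have eq_w' : ((d - u) * m' o1 + d * m' ord0 = (d - u) * m o1 + d * m ord0)%N by lia.
have [eq1 eq2] : m' o1 = m o1 /\ m' ord0 = m ord0.
  apply: (weight_inj d0 coprime_du _ _ eq_w').
    by apply: (lt_d _ (m' ord0) (d - u)%N); lia.
  by apply: (lt_d _ (m ord0) (d - u)%N); lia.
by apply: uniqE => //; left.
Qed.

End AdjointOrder.

(** * Pencils of adjoints *)

Section Pencils.

Variable K : fieldType.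
Variables u d l : nat.
Implicit Types (f g : {mpoly K[2 + 3]}) (C G : {mpoly K[3]}).

Local Notation w := (weight3 0 u d).

(** Setting T_i to 1 and the other T to 0 extracts the coefficient of T_i from a form linear in T_0,
    T_1, and does so by a ring morphism. *)
Definition pencil_comp_val (i : 'I_2) (k : 'I_(2 + 3)) : {mpoly K[3]} :=
  match split k with inl i' => (i' == i)%:R | inr j => 'X_j end.

Definition pencil_comp (i : 'I_2) f : {mpoly K[3]} :=
  mmap (@mpolyC 3 K) (pencil_comp_val i) f.

HB.instance Definition _ i :=
  GRing.RMorphism.copy (pencil_comp i) (mmap (@mpolyC 3 K) (pencil_comp_val i)).

Definition embed G : {mpoly K[2 + 3]} := G \mPo [tuple X_ K j | j < 3].

HB.instance Definition _ :=
  GRing.RMorphism.copy embed (comp_mpoly [tuple X_ K j | j < 3]).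

HB.instance Definition _ :=
  GRing.RMorphism.copy (Phi0 (K := K) u d)
    (mmap (polyC \o @mpolyC 2 K) (fun k : 'I_(2 + 3) => match split k with
                 | inl i => ('X_i)%:P
                 | inr j => 'X * (param K u d j)%:P
                 end)).

Lemma embedC k : embed k%:MP = k%:MP.
Proof. exact: comp_mpolyC. Qed.

Lemma embedX j : embed 'X_j = X_ K j.
Proof. by rewrite /embed /comp_mpoly mmapX mmap1U tnth_mktuple. Qed.

Lemma pencil_compC i k : pencil_comp i k%:MP = k%:MP.
Proof. exact: mmapC. Qed.

Lemma pencil_compT i i' : pencil_comp i (T_ K i') = (i' == i)%:R.
Proof.
rewrite /pencil_comp /T_ mmapX mmap1U /pencil_comp_val.
by rewrite (unsplitK (inl _ i')).
Qed.

Lemma pencil_compX i j : pencil_comp i (X_ K j) = 'X_j.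
Proof.
rewrite /pencil_comp /X_ mmapX mmap1U /pencil_comp_val.
by rewrite (unsplitK (inr _ j)).
Qed.

Lemma pencil_comp_embed i G : pencil_comp i (embed G) = G.
Proof.
apply: (mpoly_rmorph_ext (f := pencil_comp i \o embed) (g := idfun)) => [c|j] /=.
  by rewrite embedC pencil_compC.
by rewrite embedX pencil_compX.
Qed.

Lemma Phi0C k : Phi0 u d k%:MP = (k%:MP)%:P :> {poly {mpoly K[2]}}.
Proof. exact: (mmapC _ (polyC \o @mpolyC 2 K)). Qed.

Lemma Phi0T i : Phi0 u d (T_ K i) = ('X_i)%:P.
Proof.
rewrite [LHS](mmapX _ (polyC \o @mpolyC 2 K)) mmap1U.
by rewrite (unsplitK (inl _ i)).
Qed.

Lemma Phi0X j : Phi0 u d (X_ K j) = 'X * (param K u d j)%:P.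
Proof.
rewrite [LHS](mmapX _ (polyC \o @mpolyC 2 K)) mmap1U.
by rewrite (unsplitK (inr _ j)).
Qed.

Lemma sum_ord2 (V : nmodType) (F : 'I_2 -> V) : \sum_(i < 2) F i = F ord0 + F ord_max.
Proof.
rewrite !big_ord_recl big_ord0 addr0.
by rewrite (_ : lift ord0 ord0 = ord_max :> 'I_2) //; apply: val_inj.
Qed.

Lemma bihomog1_monomial m : bihomog 1 l ('X_[m] : {mpoly K[2 + 3]}) ->
  exists (i : 'I_2) (G : {mpoly K[3]}), G \is l.-homog /\ 'X_[m] = T_ K i * embed G.
Proof.
move=> /(_ m); rewrite msuppX mem_head => /(_ isT)[deg_T deg_X].
pose mX := [multinom m (rshift 2 j) | j < 3].
have XE : \prod_(j < 3) X_ K j ^+ m (rshift 2 j) = embed 'X_[mX].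
  rewrite mpolyXE_id rmorph_prod; apply: eq_bigr => j _.
  by rewrite rmorphXn /= embedX mnmE.
have homX : 'X_[K, mX] \is l.-homog.
  rewrite dhomogX /= mdegE -[X in _ == X]deg_X.
  by apply/eqP/eq_bigr => j _; rewrite mnmE.
have [i iE] : exists i : 'I_2, \prod_(i' < 2) T_ K i' ^+ m (lshift 3 i') = T_ K i.
  move: deg_T; rewrite !big_ord_recl !big_ord0.
  rewrite (_ : lift ord0 ord0 = ord_max :> 'I_2); last exact: val_inj.
  have [->|m0] := eqVneq (m (lshift 3 ord0)) 0%N.
    by rewrite add0n addn0 => ->; exists ord_max; rewrite mul1r mulr1.
  move=> deg1; have [-> ->] : m (lshift 3 ord0) = 1%N /\ m (lshift 3 ord_max) = 0%N by lia.
  by exists ord0; rewrite mul1r mulr1.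
exists i, 'X_[mX]; split=> //.
by rewrite mpolyXE_id big_split_ord /= -XE -iE.
Qed.

Lemma pencilE f : bihomog 1 l f ->
  f = \sum_(i < 2) T_ K i * embed (pencil_comp i f) /\
  forall i, pencil_comp i f \is l.-homog.
Proof.
move=> homf; rewrite {1 2 3}(mpolyE f).
have : forall m, m \in msupp f -> bihomog 1 l ('X_[m] : {mpoly K[2 + 3]}).
  by move=> m /homf mE m'; rewrite msuppX inE => /eqP ->.
elim: (msupp f) => [|m s IHs] hom_s.
  rewrite big_nil; split=> [|i]; last by rewrite rmorph0 rpred0.
  by rewrite big1 // => i _; rewrite !rmorph0 mulr0.
have [m' m's|sE shom] := IHs; first by apply: hom_s; rewrite inE m's orbT.
have [i0 [G [homG mE]]] := bihomog1_monomial (hom_s m (mem_head _ _)).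
have comp_m i : pencil_comp i (f@_m *: 'X_[m]) = if i0 == i then f@_m *: G else 0.
  rewrite mE -mul_mpolyC !rmorphM /= pencil_compC pencil_compT pencil_comp_embed.
  by case: eqP => _; rewrite mul_mpolyC (mul1r, mul0r) ?scaler0.
rewrite big_cons; set M := f@_m *: 'X_[m] in comp_m *.
set R := \sum_(j <- s) _ in sE shom *; split=> [|i]; last first.
  rewrite rmorphD /= rpredD ?shom // comp_m.
  by case: eqP => _; rewrite ?rpred0 // rpredZ.
transitivity (\sum_i (T_ K i * embed (pencil_comp i M) +
                      T_ K i * embed (pencil_comp i R))); last first.
  by apply: eq_bigr => i _; rewrite rmorphD /= rmorphD /= mulrDr.
rewrite big_split; congr (_ + _); last exact: sE.
rewrite (bigD1 i0) //= comp_m eqxx.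
rewrite big1 ?addr0 => [|i /negPf i_neq].
  by rewrite -mul_mpolyC rmorphM /= embedC /M mE mulrCA mul_mpolyC.
by rewrite comp_m eq_sym i_neq rmorph0 mulr0.
Qed.

(** Restriction of the coefficient of T_i to the parametrization t |-> (1, t^u, t^d). *)
Definition trace (i : 'I_2) f : {poly K} := evw w (pencil_comp i f).

Lemma rmorph_pencil (Psi : {rmorphism {mpoly K[2 + 3]} -> {poly K}}) f :
  (forall k, Psi k%:MP = k%:P) -> (forall i, Psi (T_ K i) = 'X^(weight2 0 1 i)) ->
  (forall j, Psi (X_ K j) = 'X^(w j)) -> bihomog 1 l f ->
  Psi f = trace ord0 f + 'X * trace ord_max f.
Proof.
move=> PsiC PsiT PsiX /pencilE[fE _].
have Psi_embed G : Psi (embed G) = evw w G.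
  apply: (mpoly_rmorph_ext (f := Psi \o embed)) => [c|j] /=.
    by rewrite embedC PsiC evwC.
  by rewrite embedX PsiX evwXU.
transitivity (\sum_(i < 2) 'X^(weight2 0 1 i) * trace i f).
  rewrite {1}fE rmorph_sum; apply: eq_bigr => i _.
  by rewrite rmorphM PsiT; congr (_ * _); apply: Psi_embed.
by rewrite sum_ord2 expr0 mul1r expr1.
Qed.

(** Obtained from [Phi0 u d f = 0] by setting Z = 1, T_0 = 1 and T_1 = ['X]. *)
Lemma trace_kernel f : bihomog 1 l f -> Phi0 u d f = 0 ->
  trace ord0 f + 'X * trace ord_max f = 0.
Proof.
pose ev1 : {rmorphism {poly {mpoly K[2]}} -> {poly K}} :=
  evw (weight2 0 1) \o horner_eval 1.
have ev1C (g : {mpoly K[2]}) : ev1 g%:P = evw (weight2 0 1) g.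
  by rewrite /= /horner_eval hornerC.
have ev1X : ev1 'X = 1 by rewrite /= /horner_eval hornerX rmorph1.
move: ev1 ev1C ev1X => ev1 ev1C ev1X homf kerf.
rewrite -(rmorph_pencil (Psi := ev1 \o Phi0 (K := K) u d)) //=.
- by rewrite kerf rmorph0.
- by move=> k; rewrite Phi0C ev1C evwC.
- by move=> i; rewrite Phi0T ev1C evwXU.
move=> j; rewrite Phi0X rmorphM /= ev1X ev1C mul1r.
have [->|->|->] := ord3E j; rewrite /param /tnth /=.
- by rewrite rmorphXn /= evwXU expr0 expr1n.
- by rewrite rmorphM !rmorphXn /= !evwXU expr0 expr1n mul1r expr1.
- by rewrite rmorphXn /= evwXU expr1.
Qed.

Hypothesis closedK : forall P : {poly K}, size P != 1%N -> exists s, root P s.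
Hypothesis charK : [pchar K] =i pred0.
Hypotheses (u_gt1 : (1 < u)%N) (u_lt : (2 * u < d)%N) (cop_ud : coprime u d).

(** A coefficient of h at t^j appears at t^(j+1) in the trace of T_0 and at t^j in that of T_1. The
    cusp at t = 0 is stricter on the lower exponent j, the cusp at infinity on j+1. *)
Definition low_position (j : nat) : bool :=
  (j < d.-1 * u.-1)%N || (d * l - j.+1 < (d - u).-1 * d.-1)%N.

Lemma size_trace i f : bihomog 1 l f -> (size (trace i f) <= (d * l).+1)%N.
Proof.
move=> /pencilE[_ hom]; apply/leq_sizeP => j lt_j; apply/eqP; apply: contraT.
move=> /coef_evw_neq0[m mG]; rewrite wdeg3 => wm.
have := dhomog_mf (hom i) mG; rewrite /= mdeg3 => lE.
have : (u * m o1 <= d * m o1)%N by rewrite leq_mul2r; lia.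
by move: lt_j; rewrite -lE -wm !mulnDr; lia.
Qed.

Lemma AdjP f : kerPhi0 u d 1 l f ->
  Adj u d l f <-> forall j, (j < d * l)%N -> low_position j -> (trace ord0 f)`_j.+1 = 0.
Proof.
move=> [homf kerf]; have tr := trace_kernel homf kerf.
have trS j : (trace ord0 f)`_j.+1 = - (trace ord_max f)`_j.
  have /(congr1 (fun P : {poly K} => P`_j.+1)) := tr.
  by rewrite coefD coefXM coef0 /= => /eqP; rewrite addr_eq0 => /eqP.
have tr0 : (trace ord0 f)`_0 = 0.
  have /(congr1 (fun P : {poly K} => P`_0)) := tr.
  by rewrite coefD coefXM coef0 /= addr0.
have adjE G : G \is l.-homog -> adjoint (curve u d) G <->
    forall j, (j <= d * l)%N -> below_conductor u d l j -> (evw w G)`_j = 0.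
  exact: adjointP.
split=> [[C [adjC fE]] j lt_j bad_j|tr_bad].
  have compE i : pencil_comp i f = C i.
    have -> : f = \sum_(i < 2) T_ K i * embed (C i) by [].
    transitivity (\sum_(i' < 2) (i' == i)%:R * C i').
      rewrite rmorph_sum; apply: eq_bigr => i' _.
      by rewrite rmorphM /= pencil_compT pencil_comp_embed.
    by rewrite sum_ord2; have [->|->] := ord2E i; rewrite /= mul0r mul1r ?addr0 ?add0r.
  have coefC i j' : (j' <= d * l)%N -> below_conductor u d l j' -> (trace i f)`_j' = 0.
    rewrite /trace compE; have [homC [->|adjCi]] := adjC i.
      by rewrite rmorph0 coef0.
    exact: (proj1 (adjE _ homC) adjCi).
  case/orP: bad_j => bad_j; last by apply: coefC => //; apply/orP; right.
  by rewrite trS coefC ?oppr0 ?(ltnW lt_j) //; apply/orP; left.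
have [fE homC] := pencilE homf.
exists (pencil_comp^~ f); split; last exact: fE.
move=> i; split; first exact: homC.
right; apply: (proj2 (adjE _ (homC i))) => j le_j bad_j; rewrite -/(trace i f).
have [->|->] := ord2E i.
  case: j => [//|j] in le_j bad_j *; apply: tr_bad => //.
  by move: bad_j; rewrite /below_conductor /low_position; lia.
apply/eqP; rewrite -oppr_eq0 -trS; apply/eqP.
(* The top position j = d l is settled by the degree bound on the trace of T_0. *)
have [lt_j|ge_j] := ltnP j (d * l).
  by apply: tr_bad => //; move: bad_j; rewrite /below_conductor /low_position; lia.
by have /leq_sizeP -> := size_trace ord0 homf; rewrite ?ltnS.
Qed.

Definition binomial_pencil (p r : 'X_{1..3}) : {mpoly K[2 + 3]} :=
  T_ K ord0 * embed 'X_[p] - T_ K ord_max * embed 'X_[r].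

Lemma trace_binomial p r j :
  (trace ord0 (binomial_pencil p r))`_j = (j == wdeg w p)%:R.
Proof.
rewrite /trace /binomial_pencil rmorphB !rmorphM /= !pencil_compT !pencil_comp_embed.
by rewrite /= mul0r subr0 mul1r evwX coefXn.
Qed.

Lemma embedXm m : embed 'X_[m] =
  X_ K ord0 ^+ m ord0 * X_ K o1 ^+ m o1 * X_ K ord_max ^+ m ord_max.
Proof.
rewrite mpolyXE_id !big_ord_recl big_ord0 mulr1 !rmorphM !rmorphXn /= !embedX mulrA.
by rewrite (_ : lift ord0 (lift ord0 ord0) = ord_max) //; apply: val_inj.
Qed.

Lemma bihomog_T_embed i m : mdeg m = l -> bihomog 1 l (T_ K i * embed 'X_[m]).
Proof.
rewrite mdeg3 => degm; rewrite embedXm /T_ /X_ !mpolyXn -!mpolyXD => m'.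
rewrite msuppX inE => /eqP ->; split.
  by have [->|->] := ord2E i; rewrite !big_ord_recl big_ord0 !mnmDE !mulmnE !mnm1E /=; lia.
by have [->|->] := ord2E i; rewrite !big_ord_recl big_ord0 !mnmDE !mulmnE !mnm1E /=; lia.
Qed.

Lemma scaled_monomial (A : comNzRingType) (z a b c : A) i j k :
  (z * a) ^+ i * (z * b) ^+ j * (z * c) ^+ k =
  z ^+ (i + j + k) * (a ^+ i * b ^+ j * c ^+ k).
Proof. by rewrite !exprMn !exprD; ring. Qed.

Lemma param_monomial (A : comNzRingType) (s t : A) (e i j k : nat) :
  (s ^+ d) ^+ i * (s ^+ e * t ^+ u) ^+ j * (t ^+ d) ^+ k =
  s ^+ (d * i + e * j) * t ^+ (u * j + d * k).
Proof. by rewrite !exprMn -!exprM !exprD; ring. Qed.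

Lemma Phi0_embed m : mdeg m = l -> Phi0 u d (embed 'X_[m]) = 'X^l *
    ('X_ord0 ^+ (d * l - wdeg w m) * 'X_ord_max ^+ (wdeg w m))%:P.
Proof.
move=> degm; have := degm; rewrite mdeg3 wdeg3 mul0n add0n => lE.
rewrite embedXm.
transitivity (('X * (param K u d ord0)%:P) ^+ m ord0 *
  ('X * (param K u d o1)%:P) ^+ m o1 * ('X * (param K u d ord_max)%:P) ^+ m ord_max).
  by rewrite (rmorphM (Phi0 u d)) (rmorphM (Phi0 u d)) !(rmorphXn (Phi0 u d)) /= !Phi0X.
rewrite scaled_monomial lE -!rmorphXn -!polyCM; congr (_ * _%:P).
rewrite /param /tnth /= param_monomial; congr ('X_ _ ^+ _ * _).
rewrite -lE; have : (d * m o1 = u * m o1 + (d - u) * m o1)%N.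
  by rewrite -mulnDl subnKC //; lia.
by lia.
Qed.

Lemma binomial_pencil_kerPhi0 p r : mdeg p = l -> mdeg r = l ->
  wdeg w p = (wdeg w r).+1 -> kerPhi0 u d 1 l (binomial_pencil p r).
Proof.
move=> degp degr wpr; split.
  move=> m /msuppB_le; rewrite mem_cat => /orP[]; exact: bihomog_T_embed.
have le_p : (wdeg w p <= d * l)%N.
  rewrite wdeg3 -degp mdeg3 !mulnDr mul0n add0n.
  have : (u * p o1 <= d * p o1)%N by rewrite leq_mul2r; lia.
  lia.
rewrite /binomial_pencil (rmorphB (Phi0 u d)) !(rmorphM (Phi0 u d)) /=.
rewrite !Phi0T !Phi0_embed // wpr mulrCA (mulrCA _ 'X^l) -mulrBr -!polyCM -polyCB.
rewrite (_ : _ - _ = 0) ?mulr0 //; apply/eqP; rewrite subr_eq0; apply/eqP.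
rewrite mulrA -exprS [RHS]mulrCA -exprS; congr ('X_ _ ^+ _ * _).
by rewrite wpr in le_p; rewrite subnSK.
Qed.

End Pencils.

(** The functionals [h x] cut V out of W and are dual to the family [e], so the coefficient of [e x]
    in w modulo V is forced to be [h x w]. *)
Lemma quotient_dim_dual (K : fieldType) (E : lmodType K) (W V : E -> Prop)
    (D : finType) (e : D -> E) (h : D -> E -> K) :
  (forall x, W (e x)) ->
  (forall w (c : D -> K), W w -> W (w - \sum_x c x *: e x)) ->
  (forall x w (c : D -> K), h x (w - \sum_y c y *: e y) = h x w - c x) ->
  (forall w, W w -> V w <-> forall x, h x w = 0) ->
  quotient_dim W V #|D|.
Proof.
move=> We Wsub hE VE; exists (e \o enum_val); split=> [i|w Ww]; first exact: We.
have sumE (c : {ffun 'I_#|D| -> K}) :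
    \sum_(i < #|D|) c i *: (e \o enum_val) i = \sum_x c (enum_rank x) *: e x.
  rewrite (reindex (@enum_rank D)) /=; last exact/onW_bij/enum_rank_bij.
  by apply: eq_bigr => x _; rewrite enum_rankK.
exists [ffun i => h (enum_val i) w]; split=> [|c [Vc Wc]].
  rewrite sumE; split; last exact: Wsub.
  apply/VE; first exact: Wsub.
  by move=> x; rewrite hE ffunE enum_rankK subrr.
apply/ffunP => i; rewrite ffunE; apply/eqP; rewrite -subr_eq0.
move/VE: Vc => /(_ Wc (enum_val i)); rewrite sumE hE enum_valK => ->.
exact: eqxx.
Qed.

(** * A basis of the quotient made of multiples of two binomial pencils *)

Section Basis.

Variable K : fieldType.
Hypothesis closedK : forall P : {poly K}, size P != 1%N -> exists s, root P s.
Hypothesis charK : [pchar K] =i pred0.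
Variables u d l : nat.
Hypotheses (u_gt1 : (1 < u)%N) (u_lt : (2 * u < d)%N) (cop_ud : coprime u d).

Local Notation w := (weight3 0 u d).
Local Notation triple := ('I_l.+1 * 'I_l.+1 * 'I_l.+1)%type.

(* e is the degree in X of a binomial pencil, j and i are the exponents of T_1 and
   T_0 in the monomial h attached to it. *)
Definition low_triples (e j i : nat) : {set triple} :=
  [set x : triple | (x.1.1 + x.1.2 + x.2 + e == l)%N &&
    ((u * x.1.2 + d * x.2 + j < d.-1 * u.-1)%N ||
     (d * x.1.1 + (d - u) * x.1.2 + i < (d - u).-1 * d.-1)%N)].

Lemma kerPhi0B f g : kerPhi0 (K := K) u d 1 l f -> kerPhi0 u d 1 l g ->
  kerPhi0 u d 1 l (f - g).
Proof.
move=> [homf kerf] [homg kerg]; split; last first.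
  by have /= -> := rmorphB (Phi0 (K := K) u d) f g; rewrite kerf kerg subr0.
by move=> m /msuppB_le; rewrite mem_cat => /orP[/homf|/homg].
Qed.

Lemma kerPhi0_sum (D : finType) (c : D -> K) (e : D -> {mpoly K[2 + 3]}) :
  (forall x, kerPhi0 u d 1 l (e x)) -> kerPhi0 u d 1 l (\sum_x c x *: e x).
Proof.
move=> ker_e; split; last first.
  rewrite rmorph_sum big1 // => x _; have [_ ker_x] := ker_e x.
  by rewrite -mul_mpolyC rmorphM /= ker_x mulr0.
move=> m /msupp_sum_le/flattenP[s /mapP[x _ ->] /msuppZ_le].
by have [hom_x _] := ker_e x; apply: hom_x.
Qed.

Lemma trace0_sum (D : finType) (c : D -> K) (e : D -> {mpoly K[2 + 3]}) f k :
  (trace u d ord0 (f - \sum_x c x *: e x))`_k =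
  (trace u d ord0 f)`_k - \sum_x c x * (trace u d ord0 (e x))`_k.
Proof.
rewrite /trace (rmorphB (pencil_comp ord0)) (rmorphB (evw w)) coefB; congr (_ - _).
rewrite (rmorph_sum (pencil_comp ord0)) (rmorph_sum (evw w)) coef_sum.
apply: eq_bigr => x _.
by rewrite -mul_mpolyC !rmorphM /= pencil_compC evwC coefCM.
Qed.

Definition mono3 (a b c : nat) : 'X_{1..3} := [multinom weight3 a b c i | i < 3].

Lemma mono3E a b c :
  [/\ mono3 a b c ord0 = a, mono3 a b c o1 = b & mono3 a b c ord_max = c].
Proof. by rewrite !mnmE. Qed.

Lemma wdeg_mono3 a b c : wdeg w (mono3 a b c) = (u * b + d * c)%N.
Proof. by rewrite wdeg3; have [-> -> ->] := mono3E a b c; rewrite mul0n. Qed.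

Lemma mdeg_mono3 a b c : mdeg (mono3 a b c) = (a + b + c)%N.
Proof. by rewrite mdeg3; have [-> -> ->] := mono3E a b c. Qed.

(** An exponent of X_1 at least d gives order at least u d at one cusp and (d-u) d at the other,
    beyond both conductors even after a shift by one. *)
Lemma low_position_lt j a0 a1 a2 : low_position u d l j -> (a0 + a1 + a2 = l)%N ->
  (u * a1 + d * a2 = j \/ u * a1 + d * a2 = j.+1)%N -> (a1 < d)%N.
Proof.
move=> bad_j degl wj; rewrite ltnNge; apply/negP => le_d.
have wl : (u * a1 + d * a2 + (d * a0 + (d - u) * a1) = d * l)%N.
  rewrite -degl; have : (d * a1 = u * a1 + (d - u) * a1)%N.
    by rewrite -mulnDl subnKC //; lia.
  lia.
have h1 : (u * d <= u * a1)%N by rewrite leq_mul2l le_d orbT.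
have h2 : ((d - u) * d <= (d - u) * a1)%N by rewrite leq_mul2l le_d orbT.
have c1 : (d.-1 * u.-1 < u * d)%N by rewrite mulnC ltn_mul ?ltn_predL //; lia.
have c2 : ((d - u).-1 * d.-1 < (d - u) * d)%N by rewrite ltn_mul ?ltn_predL //; lia.
case/orP: bad_j; lia.
Qed.

Variables e t e' t' : nat.
Hypotheses (e_gt0 : (0 < e)%N) (e'_gt0 : (0 < e')%N) (ee' : (e + e' = d)%N).
Hypotheses (bezout : (u * e = d * t + 1)%N) (bezout' : (d * t' = u * e' + 1)%N).

Lemma t_le : (t <= e)%N. Proof. nia. Qed.

Lemma t'_le : (t' <= e')%N. Proof. nia. Qed.

Lemma ude : ((d - u) * e + d * t + 1 = d * e)%N.
Proof. by rewrite -addnA -bezout -mulnDl subnK //; lia. Qed.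

Lemma ude' : (d * (e' - t') + u * e' + 1 = d * e')%N.
Proof. by rewrite -addnA -bezout' -mulnDr subnK // t'_le. Qed.

Local Notation SA := (low_triples e (d * t) ((d - u) * e)).
Local Notation SB := (low_triples e' (u * e') (d * (e' - t'))).
Local Notation index := ({x | x \in SA} + {x | x \in SB})%type.

(** [inl] and [inr] choose between the two binomials; [exponent0] and [exponent1] belong to the
    monomials multiplied by T_0 and T_1. *)
Definition exponent0 (x : index) : 'X_{1..3} :=
  match x with
  | inl y => mono3 (val y).1.1 ((val y).1.2 + e) (val y).2
  | inr y => mono3 ((val y).1.1 + (e' - t')) (val y).1.2 ((val y).2 + t')
  end.

Definition exponent1 (x : index) : 'X_{1..3} :=
  match x with
  | inl y => mono3 ((val y).1.1 + (e - t)) (val y).1.2 ((val y).2 + t)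
  | inr y => mono3 (val y).1.1 ((val y).1.2 + e') (val y).2
  end.

Definition position (x : index) : nat := wdeg w (exponent1 x).

Lemma index_props x :
  [/\ mdeg (exponent0 x) = l, mdeg (exponent1 x) = l,
      wdeg w (exponent0 x) = (position x).+1, (position x < d * l)%N &
      low_position u d l (position x)].
Proof.
rewrite /position /exponent0 /exponent1.
have := t_le; have := t'_le; have := ude; have := ude' => ude' ude t'_le t_le.
have split_d a : (d * a = u * a + (d - u) * a)%N by rewrite -mulnDl subnKC //; lia.
case: x => -[[[a0 a1] a2] /= ]; rewrite inE /= => /andP[/eqP degl low].
  rewrite !mdeg_mono3 !wdeg_mono3.
  have pE : (u * (a1 + e) + d * a2 = (u * a1 + d * (a2 + t)).+1)%N by lia.
  (* The last summand is the order of the T_0 monomial at the cusp t = infinity, so the second bound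
     of [low_triples] becomes that of [low_position]. *)
  have dl : (d * l = (u * a1 + d * (a2 + t)).+1 +
      (d * a0 + (d - u) * a1 + (d - u) * e))%N.
    by have := congr1 (muln d) degl; rewrite !mulnDr; have := split_d a1; lia.
  split=> //; [lia|lia|by rewrite dl addSn ltnS leq_addr|].
  by rewrite /low_position dl addKn; case/orP: low => ?; apply/orP; [left|right]; lia.
rewrite !mdeg_mono3 !wdeg_mono3.
have pE : (u * a1 + d * (a2 + t') = (u * (a1 + e') + d * a2).+1)%N by lia.
have dl : (d * l = (u * (a1 + e') + d * a2).+1 +
    (d * a0 + (d - u) * a1 + d * (e' - t')))%N.
  by have := congr1 (muln d) degl; rewrite !mulnDr; have := split_d a1; lia.
split=> //; [lia|lia|by rewrite dl addSn ltnS leq_addr|].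
by rewrite /low_position dl addKn; case/orP: low => ?; apply/orP; [left|right]; lia.
Qed.

(** At a low position the weights determine both monomials. From T_1 to T_0 the exponent of X_1
    grows by e in the first family and drops by e' in the second, so the families do not meet. *)
Lemma position_inj : injective position.
Proof.
have d_gt0 : (0 < d)%N by lia.
have key x y : position x = position y ->
    exponent0 x o1 = exponent0 y o1 /\ exponent1 x o1 = exponent1 y o1 /\
    exponent1 x ord_max = exponent1 y ord_max.
  move=> eq_xy.
  have [degx0 degx1 wx _ badx] := index_props x.
  have [degy0 degy1 wy _ bady] := index_props y.
  have lt0 z : (exponent0 z o1 < d)%N.
    have [deg0 _ wz _ badz] := index_props z; rewrite mdeg3 in deg0.
    by apply: (low_position_lt badz deg0); right; rewrite -wz wdeg3 mul0n.
  have lt1 z : (exponent1 z o1 < d)%N.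
    have [_ deg1 _ _ badz] := index_props z; rewrite mdeg3 in deg1.
    by apply: (low_position_lt badz deg1); left; rewrite /position wdeg3 mul0n.
  have [eq0 _] : exponent0 x o1 = exponent0 y o1 /\ exponent0 x ord_max = exponent0 y ord_max.
    apply: (weight_inj d_gt0 cop_ud (lt0 x) (lt0 y)).
    have : wdeg w (exponent0 x) = wdeg w (exponent0 y) by rewrite wx wy eq_xy.
    by rewrite !wdeg3.
  have [eq1 eq2] :
      exponent1 x o1 = exponent1 y o1 /\ exponent1 x ord_max = exponent1 y ord_max.
    apply: (weight_inj d_gt0 cop_ud (lt1 x) (lt1 y)).
    by move: eq_xy; rewrite /position !wdeg3.
  by [].
have sub_inj (S : {set triple}) (y z : {x | x \in S}) (n : nat) :
    (forall x, x \in S -> x.1.1 + x.1.2 + x.2 + n = l)%N ->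
    (val y).1.2 = (val z).1.2 :> nat -> (val y).2 = (val z).2 :> nat -> y = z.
  move=> degS; case: y z => [[[a0 a1] a2] yS] [[[b0 b1] b2] zS] /= eq1 eq2.
  apply: val_inj => /=; have := degS _ yS; have := degS _ zS => /= deg_z deg_y.
  by congr (_, _, _); apply: ord_inj; lia.
have degA x : x \in SA -> (x.1.1 + x.1.2 + x.2 + e = l)%N.
  by rewrite inE => /andP[/eqP].
have degB x : x \in SB -> (x.1.1 + x.1.2 + x.2 + e' = l)%N.
  by rewrite inE => /andP[/eqP].
move=> x y /key; rewrite /exponent0 /exponent1.
case: x y => [y|y] [z|z] /=; rewrite !mnmE /weight3 /= => -[eq0 [eq1 eq2]].
- by congr inl; apply: (sub_inj _ _ _ e degA) => /=; lia.
- by lia.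
- by lia.
- by congr inr; apply: (sub_inj _ _ _ e' degB) => /=; lia.
Qed.

(** Since u e = 1 modulo d, the exponent of X_1 in p is that in r plus e modulo d. Both are below d,
    so it is either r_1 + e or r_1 + e - d = r_1 - e', which are the two families. *)
Lemma position_onto j (p r : 'X_{1..3}) : low_position u d l j ->
  mdeg p = l -> mdeg r = l -> wdeg w p = j.+1 -> wdeg w r = j ->
  exists x, position x = j.
Proof.
have := t_le; have := t'_le; have := ude; have := ude' => ude' ude t'_le t_le.
have split_d a : (d * a = u * a + (d - u) * a)%N by rewrite -mulnDl subnKC //; lia.
have d_gt0 : (0 < d)%N by lia.
rewrite !mdeg3 !wdeg3 !mul0n !add0n => bad_j degp degr wp wr.
have lt_p := low_position_lt bad_j degp (or_intror wp).
have lt_r := low_position_lt bad_j degr (or_introl wr).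
have [lt_re|ge_re] := ltnP (r o1 + e) d.
  have [p1 p2] : p o1 = (r o1 + e)%N /\ (p ord_max + t)%N = r ord_max.
    by apply: (weight_inj d_gt0 cop_ud lt_p lt_re); lia.
  pose y : triple := (inord (p ord0), inord (r o1), inord (p ord_max)).
  have yS : y \in SA.
    rewrite inE /= !inordK; [|lia|lia|lia]; apply/andP; split; first by apply/eqP; lia.
    have dl : (d * l = j.+1 + (d * p ord0 + (d - u) * r o1 + (d - u) * e))%N.
      by rewrite -degp -wp; have := split_d (r o1); lia.
    by move: bad_j; rewrite /low_position dl addKn => /orP[?|?]; apply/orP; [left|right]; lia.
  exists (inl (exist _ y yS)); rewrite /position /= wdeg_mono3 !inordK; lia.
have [s rE] : exists s, r o1 = (s + e')%N by exists (r o1 - e')%N; lia.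
have lt_s : (s < d)%N by lia.
have [p1 p2] : p o1 = s /\ p ord_max = (r ord_max + t')%N.
  by apply: (weight_inj d_gt0 cop_ud lt_p lt_s); lia.
pose y : triple := (inord (r ord0), inord s, inord (r ord_max)).
have yS : y \in SB.
  rewrite inE /= !inordK; [|lia|lia|lia]; apply/andP; split; first by apply/eqP; lia.
  have dl : (d * l = j.+1 + (d * r ord0 + (d - u) * s + d * (e' - t')))%N.
    by rewrite -degr -wr; have := split_d s; lia.
  by move: bad_j; rewrite /low_position dl addKn => /orP[?|?]; apply/orP; [left|right]; lia.
exists (inr (exist _ y yS)); rewrite /position /= wdeg_mono3 !inordK; lia.
Qed.

(** The trace of T_0 in a binomial pencil is a single power of t, so the coefficients at the
    distinct positions form the dual family. *)
Lemma quotient_dim_pencils :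
  quotient_dim (kerPhi0 (K := K) u d 1 l) (Adj (K := K) u d l) (#|SA| + #|SB|).
Proof.
pose elem (x : index) : {mpoly K[2 + 3]} := binomial_pencil K (exponent0 x) (exponent1 x).
pose h (x : index) (f : {mpoly K[2 + 3]}) : K := (trace u d ord0 f)`_(position x).+1.
have ker_elem x : kerPhi0 u d 1 l (elem x).
  have [deg0 deg1 wx _ _] := index_props x.
  by apply: binomial_pencil_kerPhi0 => //; rewrite wx.
have trace_elem x y : (trace u d ord0 (elem y))`_(position x).+1 = (y == x)%:R.
  rewrite trace_binomial; have [_ _ -> _ _] := index_props y.
  by rewrite eqSS (inj_eq position_inj) eq_sym.
have -> : (#|SA| + #|SB|)%N = #|{: index}| by rewrite card_sum !card_sig.
apply: (@quotient_dim_dual K _ _ _ _ elem h).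
- exact: ker_elem.
- by move=> f c ker_f; exact: kerPhi0B ker_f (kerPhi0_sum _ ker_elem).
- move=> x f c; apply: etrans (trace0_sum c elem f _) _; congr (_ - _).
  transitivity (\sum_y c y * (y == x)%:R).
    by apply: eq_bigr => y _; rewrite trace_elem.
  by rewrite (bigD1 x) //= eqxx mulr1 big1 ?addr0 // => y /negPf ->; rewrite mulr0.
move=> f ker_f.
have adjE : Adj u d l f <->
    forall j, (j < d * l)%N -> low_position u d l j -> (trace u d ord0 f)`_j.+1 = 0.
  exact: AdjP.
split=> [adj x|h0].
  have [_ _ _ lt_x bad_x] := index_props x.
  exact: (proj1 adjE adj).
have [hom_f Phi_f] := ker_f.
have [_ hom] := pencilE hom_f.
have tr := trace_kernel hom_f Phi_f.
(* A nonzero coefficient at a low position j needs a monomial of weight j+1 next to T_0 and one of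
   weight j next to T_1; then j is the position of a basis element. *)
apply: (proj2 adjE) => j lt_j bad_j; apply/eqP; apply: contraT => trj.
have [p pf wp] := coef_evw_neq0 trj.
have trj' : (trace u d ord_max f)`_j != 0.
  have /(congr1 (fun P : {poly K} => P`_j.+1)) := tr.
  rewrite coefD coefXM coef0 /= => /eqP; rewrite addr_eq0 => /eqP trE.
  apply: contraNneq trj => tr0; apply/eqP; apply: etrans trE _.
  by rewrite tr0 oppr0.
have [r rf wr] := coef_evw_neq0 trj'.
have [x xj] := position_onto bad_j (dhomog_mf (hom _) pf) (dhomog_mf (hom _) rf) wp wr.
by have := h0 x; rewrite /h xj => trj0; rewrite trj0 eqxx in trj.
Qed.

End Basis.

(** * Euclid's algorithm and the count *)

Section EuclidStates.

Variables u d : nat.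
Hypotheses (u_gt1 : (1 < u)%N) (u_lt : (2 * u < d)%N) (cop_ud : coprime u d).

Local Notation init := (State (d%:Z - u%:Z) u%:Z 0 1 1 0).
Local Notation nth_state n := (iter n next_state init).

Lemma next_state_sub s (c r : nat) :
  st_b s = (c + r)%N%:Z -> st_c s = c%:Z ->
  if (c <= r)%N then st_b (next_state s) = r%:Z /\ st_c (next_state s) = c%:Z
  else st_b (next_state s) = c%:Z /\ st_c (next_state s) = r%:Z.
Proof.
case: s => b' c' sg ta al be /= -> ->; rewrite /next_state.
have -> : ((c + r)%N%:Z - c%:Z = r%:Z)%R by lia.
by rewrite lez_nat; case: (c <= r)%N; split.
Qed.

(** One Euclidean division with quotient k+1, unrolled into subtractions of which only the last
    exchanges the entries. The state before that exchange is recorded because the last two states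
    enter [nu]. *)
Lemma iter_next_state s (k c r : nat) : (r < c)%N ->
  st_b s = (k.+1 * c + r)%N%:Z -> st_c s = c%:Z ->
  [/\ st_b (iter k next_state s) = (c + r)%N%:Z, st_c (iter k next_state s) = c%:Z,
      st_b (iter k.+1 next_state s) = c%:Z & st_c (iter k.+1 next_state s) = r%:Z].
Proof.
move=> lt_rc; elim: k s => [|k IHk] s sb sc.
  rewrite mul1n in sb; have := next_state_sub sb sc.
  by rewrite leqNgt lt_rc /= => -[].
have sb' : st_b s = (c + (k.+1 * c + r))%N%:Z by rewrite sb; lia.
have := next_state_sub sb' sc; rewrite (_ : (c <= k.+1 * c + r)%N); last by nia.
by move=> [nb nc]; rewrite !iterSr; have := IHk _ nb nc; rewrite !iterSr.
Qed.

(** Coprimality makes the last nonzero remainder 1. States are indexed from 1, so [nth_state q] and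
    [nth_state q.+1] have the indices [euclid_sum p qs] and its successor. *)
Lemma euclid_states (p : nat) (a qs : nat -> nat) : euclid_data u d p a qs ->
  exists q, [/\ euclid_sum p qs = q.+1,
    st_b (nth_state q) = 1 /\ st_c (nth_state q) = 1 &
    st_b (nth_state q.+1) = 1 /\ st_c (nth_state q.+1) = 0].
Proof.
move=> [a0 a1 ap step].
have p_gt1 : (1 < p)%N by case: p ap {step} => [|[|p]] //; lia.
have lt_a i : (1 <= i <= p - 1)%N -> (a i < a i.-1)%N.
  case: i => [//|[|i]] le_i; first by rewrite a0 a1; lia.
  by have [|_] := step i.+1; [lia|].
have a_state i : (i < p)%N ->
    st_b (nth_state (\sum_(1 <= k < i.+1) qs k)) = (a i)%:Z /\
    st_c (nth_state (\sum_(1 <= k < i.+1) qs k)) = (a i.+1)%:Z.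
  elim: i => [|i IHi] lt_i.
    by rewrite big_geq //= a0 a1; split=> //; lia.
  have [sb sc] := IHi (ltnW lt_i).
  have [|aE lt_ai] := step i.+1; first lia.
  have := lt_a i.+1; rewrite /= in aE * => /(_ _) lt_ai'.
  rewrite big_nat_recr //= addnC iterD.
  case qE : (qs i.+1) => [|k]; first by rewrite qE in aE; lia.
  by rewrite aE qE in sb; have [] := iter_next_state lt_ai sb sc.
have cop_a i : (i < p)%N -> gcdn (a i) (a i.+1) = 1%N.
  elim: i => [|i IHi] lt_i.
    rewrite a0 a1; apply/eqP; rewrite -/(coprime _ _) coprime_sym coprime_subr //.
    by lia.
  have [|aE _] := step i.+1; first by lia.
  by have := IHi (ltnW lt_i); rewrite gcdnC [a i]aE gcdnMDl.
case: p p_gt1 ap a_state cop_a lt_a step => [|[|p]] // _ ap a_state cop_a lt_a step.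
have a1_eq1 : a p.+1 = 1%N by have := cop_a p.+1 (leqnn _); rewrite ap gcdn0.
have [|sb sc] := a_state p; first by lia.
have [|aE lt_ap] := step p.+1; first by lia.
rewrite /= in aE; rewrite /euclid_sum big_nat_recr //=.
case qE : (qs p.+1) => [|k].
  by have := lt_a p.+1; rewrite qE in aE; rewrite /= => /(_ _); lia.
rewrite qE in aE; rewrite aE in sb.
have := iter_next_state lt_ap sb sc; rewrite -!iterD a1_eq1 ap addn0.
set q := (\sum_(1 <= k < p.+1) qs k)%N => -[nb nc nb' nc'].
by exists (k + q)%N; split=> //; rewrite addnC.
Qed.

(** Each step is a unimodular operation on the two rows of coefficients. The rows have opposite sign
    patterns, so subtracting one from the other never mixes signs. *)
Lemma state_invariant n : let s := nth_state n in
  [/\ st_b s = st_tau s * (d%:Z - u%:Z) + st_sigma s * u%:Z,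
      st_c s = st_beta s * (d%:Z - u%:Z) + st_alpha s * u%:Z,
      `|st_sigma s * st_beta s - st_tau s * st_alpha s| = 1 &
      [/\ 0 <= st_sigma s, st_tau s <= 0, st_alpha s <= 0 & 0 <= st_beta s] \/
      [/\ st_sigma s <= 0, 0 <= st_tau s, 0 <= st_alpha s & st_beta s <= 0]].
Proof.
elim: n => [|n] /=.
  by split=> //=; [lia|lia|right].
case: (nth_state n) => b c sg ta al be /= [bE cE det signs].
rewrite /next_state; case: ifP => _ /=.
  split=> //; [by rewrite bE cE; ring| |].
    by rewrite -det; congr `|_|; ring.
  by case: signs => -[? ? ? ?]; [left|right]; split; lia.
split=> //; [by rewrite bE cE; ring| |].
  by rewrite -det -normrN; congr `|_|; ring.
by case: signs => -[? ? ? ?]; [right|left]; split; lia.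
Qed.

(* The two last states carry the two solutions of sigma u + tau (d - u) = 1 with
   entries of opposite signs; the parity of the number of exchanges decides which
   one comes first. *)
Lemma euclid_bezout (p : nat) (a qs : nat -> nat) : euclid_data u d p a qs ->
  exists e t e' t', [/\ (u * e = d * t + 1)%N, (d * t' = u * e' + 1)%N, (e + e' = d)%N,
    (0 < e)%N /\ (0 < e')%N &
    let q := euclid_sum p qs in
    let n := `|sigma u d q - tau u d q| in
    let n' := `|sigma u d q.+1 - tau u d q.+1| in
    [/\ n = e%:Z, `|tau u d q| = t%:Z, n' = e'%:Z & `|sigma u d q.+1| = (e' - t')%N%:Z] \/
    [/\ n = e'%:Z, `|tau u d q| = t'%:Z, n' = e%:Z & `|sigma u d q.+1| = (e - t)%N%:Z]].
Proof.
move=> /euclid_states[q [-> [b1 c1] [b2 c2]]] /=.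
rewrite /sigma /tau /state_at /=.
have [] := state_invariant q; move: b1 c1 b2 c2; rewrite iterS.
case: (nth_state q) => b c sg ta al be /= -> -> /= _ _ bE cE det signs.
(* At the end b = c = 1, so the difference of the rows is a relation between u and d-u. Cramer's
   rule with determinant 1 or -1 makes it plus or minus (d-u, -u). *)
have xE : (sg - al) * u%:Z + (ta - be) * (d%:Z - u%:Z) = 0 by lia.
have x_det : sg - al = (d%:Z - u%:Z) * (sg * be - ta * al).
  have -> : sg - al = (sg - al) * (be * (d%:Z - u%:Z) + al * u%:Z) by rewrite -cE mulr1.
  have -> : (d%:Z - u%:Z) * (sg * be - ta * al) =
    (sg - al) * (be * (d%:Z - u%:Z) + al * u%:Z) -
    al * ((sg - al) * u%:Z + (ta - be) * (d%:Z - u%:Z)) by ring.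
  by rewrite xE mulr0 subr0.
have y_det : ta - be = - u%:Z * (sg * be - ta * al).
  have -> : ta - be = (ta - be) * (be * (d%:Z - u%:Z) + al * u%:Z) by rewrite -cE mulr1.
  have -> : - u%:Z * (sg * be - ta * al) =
    (ta - be) * (be * (d%:Z - u%:Z) + al * u%:Z) -
    be * ((sg - al) * u%:Z + (ta - be) * (d%:Z - u%:Z)) by ring.
  by rewrite xE mulr0 subr0.
have {}xE : sg - al = d%:Z - u%:Z /\ ta - be = - u%:Z \/
            sg - al = u%:Z - d%:Z /\ ta - be = u%:Z.
  have [D|D] : sg * be - ta * al = 1 \/ sg * be - ta * al = - 1 by lia.
    by left; rewrite x_det y_det D !mulr1.
  by right; rewrite x_det y_det D !mulrN1 opprB opprK.
clear x_det y_det det; case: signs => -[s1 s2 s3 s4].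
  (* The relation sigma u + tau (d-u) = 1 reads u (sigma - tau) = 1 - d tau, whence e and t; the
     other row reads d beta = u (beta - alpha) + 1, whence e' and t'. *)
  have [e eE] : exists e : nat, sg - ta = e%:Z by exists `|sg - ta|%N; lia.
  have [t tE] : exists t : nat, ta = - t%:Z by exists `|ta|%N; lia.
  have [e' e'E] : exists e' : nat, be - al = e'%:Z by exists `|be - al|%N; lia.
  have [t' t'E] : exists t' : nat, be = t'%:Z by exists `|be|%N; lia.
  have sgE : sg = e%:Z - t%:Z by lia.
  have alE : al = t'%:Z - e'%:Z by lia.
  subst sg ta be al; have u_e : (u * e = d * t + 1)%N by clear xE; lia.
  have d_t' : (d * t' = u * e' + 1)%N by clear xE; lia.
  have [e0 e'0] : (0 < e)%N /\ (0 < e')%N by split; nia.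
  exists e, t, e', t'; split=> //; first by lia.
  by left; split; lia.
have [e eE] : exists e : nat, be - al = - e%:Z by exists `|be - al|%N; lia.
have [t tE] : exists t : nat, be = - t%:Z by exists `|be|%N; lia.
have [e' e'E] : exists e' : nat, ta - sg = e'%:Z by exists `|ta - sg|%N; lia.
have [t' t'E] : exists t' : nat, ta = t'%:Z by exists `|ta|%N; lia.
have alE : al = e%:Z - t%:Z by lia.
have sgE : sg = t'%:Z - e'%:Z by lia.
subst sg ta be al; have u_e : (u * e = d * t + 1)%N by clear xE; lia.
have d_t' : (d * t' = u * e' + 1)%N by clear xE; lia.
have [e0 e'0] : (0 < e)%N /\ (0 < e')%N by split; nia.
exists e, t, e', t'; split=> //; first by lia.
by right; split; lia.
Qed.

End EuclidStates.

Section Counting.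

Variables u d l : nat.
Hypotheses (u_gt1 : (1 < u)%N) (u_lt : (2 * u < d)%N) (cop_ud : coprime u d).

Lemma triple_count_low (e j i : nat) (J I : int) : J = j%:Z -> I = i%:Z ->
  triple_count u d l e%:Z ((d%:Z - 1) * (u%:Z - 1) - J)
    ((d%:Z - 1) * (d%:Z - u%:Z - 1) - I) = #|low_triples u d l e j i|.
Proof.
move=> -> ->.
have c1E : (d%:Z - 1) * (u%:Z - 1) = (d.-1 * u.-1)%N%:Z.
  by rewrite PoszM; congr (_ * _); lia.
have c2E : (d%:Z - 1) * (d%:Z - u%:Z - 1) = ((d - u).-1 * d.-1)%N%:Z.
  by rewrite mulrC PoszM; congr (_ * _); lia.
rewrite /triple_count c1E c2E; apply: eq_card => x; rewrite !inE.
have duE : (d - u)%N%:Z = d%:Z - u%:Z by lia.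
congr (_ && (_ || _)); first by apply/eqP/eqP; lia.
  by rewrite -!PoszM; apply/idP/idP; lia.
by rewrite -duE -!PoszM; apply/idP/idP; lia.
Qed.

(** Otherwise a (x+1) + b (y+1) = a b, so b divides x+1, which leaves no room for b (y+1). *)
Lemma frobenius_number a b x y : coprime a b -> (0 < a)%N -> (0 < b)%N ->
  (a * x + b * y + 1 != a.-1 * b.-1)%N.
Proof.
move=> cop_ab a0 b0; apply/eqP => eq_ab.
have prodE : (a.-1 * b.-1 + a + b = a * b + 1)%N.
  by case: a b a0 b0 {cop_ab eq_ab} => [|a] [|b] //= _ _; lia.
have sumE : (a * x.+1 + b * y.+1 = a * b)%N by rewrite !mulnS; lia.
have : (b %| a * x.+1)%N.
  by rewrite -(dvdn_addl _ (dvdn_mulr y.+1 (dvdnn b))) sumE dvdn_mull.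
rewrite Gauss_dvdr; last by rewrite coprime_sym.
move=> /dvdn_leq le_b; have : (a * b <= a * x.+1)%N by rewrite leq_mul2l le_b ?orbT.
by have := muln_gt0 b y.+1; rewrite b0 /=; lia.
Qed.

(** The two sets could differ only at a value one below a conductor, which [frobenius_number]
    excludes. *)
Lemma low_triples_shift e a b a' b' :
  low_triples u d l e (u * a + d * b).+1 (d * a' + (d - u) * b').+1 =
  low_triples u d l e (u * a + d * b) (d * a' + (d - u) * b').
Proof.
have u_gt0 : (0 < u)%N by lia.
have d_gt0 : (0 < d)%N by lia.
have du_gt0 : (0 < d - u)%N by lia.
apply/setP => x; rewrite !inE; congr (_ && (_ || _)).
  have := frobenius_number (x.1.2 + a) (x.2 + b) cop_ud u_gt0 d_gt0.
  rewrite !mulnDr (mulnC _ d.-1); move: (_.-1 * _)%N => c neq.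
  by rewrite addnS [LHS]ltn_neqAle addnACA -addn1 neq.
have cop_du := coprime_du u_gt1 u_lt cop_ud.
have := frobenius_number (x.1.2 + b') (x.1.1 + a') cop_du du_gt0 d_gt0.
rewrite !mulnDr; move: (_.-1 * _)%N => c neq.
by rewrite addnS [LHS]ltn_neqAle (addnC (d * _)%N) (addnC (d * a')%N) addnACA -addn1 neq.
Qed.

Lemma nu_low (q e t e' t' : nat) :
  let n := `|sigma u d q - tau u d q| in
  let n' := `|sigma u d q.+1 - tau u d q.+1| in
  (u * e = d * t + 1)%N -> (d * t' = u * e' + 1)%N -> (t <= e)%N -> (t' <= e')%N ->
  [/\ n = e%:Z, `|tau u d q| = t%:Z, n' = e'%:Z & `|sigma u d q.+1| = (e' - t')%N%:Z] \/
  [/\ n = e'%:Z, `|tau u d q| = t'%:Z, n' = e%:Z & `|sigma u d q.+1| = (e - t)%N%:Z] ->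
  nu u d q l = (#|low_triples u d l e (d * t) ((d - u) * e)| +
                #|low_triples u d l e' (u * e') (d * (e' - t'))|)%N.
Proof.
move=> n n' bez bez' le_t le_t'.
have ude : ((d - u) * e + d * t + 1 = d * e)%N.
  by rewrite -addnA -bez -mulnDl subnK //; lia.
have ude' : ((d - u) * e' + d * t' = d * e' + 1)%N.
  by rewrite bez' addnA -mulnDl subnK //; lia.
rewrite /nu -/n -/n' => -[[-> -> -> ->]|[-> -> -> ->]].
  congr (_ + _)%N; apply: triple_count_low; rewrite -?PoszM //.
  by rewrite PoszM; congr (_ * _); lia.
(* In the exchanged order all four offsets are larger by one: u e = d t + 1, d (e-t) = (d-u) e + 1,
   d t' = u e' + 1 and (d-u) e' = d (e'-t') + 1. *)
rewrite addnC; congr (_ + _)%N.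
  have := low_triples_shift e 0 t 0 e; rewrite !muln0 !add0n => <-.
  apply: triple_count_low; rewrite -PoszM; congr Posz; first by lia.
  by rewrite mulnBr -ude addnAC addnK addn1.
have := low_triples_shift e' e' 0 (e' - t') 0; rewrite !muln0 !addn0 => <-.
apply: triple_count_low; first by rewrite -PoszM; congr Posz; lia.
rewrite (_ : d%:Z - u%:Z = (d - u)%N%:Z); last by lia.
have le_dt' : (d * t' <= d * e')%N by rewrite leq_mul2l le_t' orbT.
by rewrite -PoszM; congr Posz; rewrite mulnBr -subSn // -addn1 -ude' addnK.
Qed.

End Counting.

Theorem theorem2p6 (K : closedFieldType) (charK : [pchar K] =i pred0)
  (u d : nat) (u_gt1 : (1 < u)%N) (u_lt : (2 * u < d)%N) (cop_ud : gcdn u d = 1%N)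
  (p : nat) (a qs : nat -> nat) (euclid : euclid_data u d p a qs)
  (l : nat) (l_ge : (d - 2 <= l)%N) :
  quotient_dim (kerPhi0 (K := K) u d 1 l) (Adj (K := K) u d l)
    (nu u d (euclid_sum p qs) l).
Proof.
have cop' : coprime u d by apply/eqP.
have closedK (P : {poly K}) : size P != 1%N -> exists s, root P s.
  by move=> /closed_rootP.
have [e [t [e' [t' [bez bez' ee' [e0 e'0] states]]]]] :=
  euclid_bezout u_gt1 u_lt cop' euclid.
have le_t := t_le u_gt1 u_lt cop' e0 e'0 ee' bez bez'.
have le_t' := t'_le u_gt1 u_lt cop' e0 e'0 ee' bez bez'.
rewrite (nu_low _ u_gt1 u_lt cop' bez bez' le_t le_t' states).
exact: (quotient_dim_pencils closedK charK).
Qed.
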